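(* Let $(M_1,g_1)$ and $(M_2,g_2)$ be Riemannian manifolds, $f_i:M_i\to(0,\infty)$ ($i=1,2$) smooth positive functions, $c\in\mathbb{R}$, and let $\tilde g_{f_1f_2}$ be the Riemannian metric on $M_1\times M_2$ defined by $$\tilde g_{f_1f_2}=\pi_1^*g_1+(f_1^h)^2\pi_2^*g_2+c^2(f_2^v)^2\,df_1^h\otimes df_1^h.$$ Let $\overset{i}{\nabla}$ be an affine connection on $M_i$ ($i=1,2$) and let $\nabla$ be the affine connection on $M_1\times M_2$ induced by $\overset{1}{\nabla}$ and $\overset{2}{\nabla}$ (defined in the context). Then $(M_1,\overset{1}{\nabla},g_1)$ and $(M_2,\overset{2}{\nabla},g_2)$ are statistical manifolds if and only if $(M_1\times M_2,\tilde g_{f_1f_2},\nabla)$ is a statistical manifold.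
   Context: Statistical manifold: for an affine connection $\nabla$ and a (pseudo-)Riemannian metric $g$ on $M$, $(M,\nabla,g)$ is a statistical manifold if $\nabla$ is torsion-free and $\nabla g$ is symmetric, i.e. $(\nabla g)(X,Y,Z):=X(g(Y,Z))-g(\nabla_XY,Z)-g(Y,\nabla_XZ)$ satisfies $(\nabla g)(X,Y,Z)=(\nabla g)(Y,X,Z)$ for all vector fields $X,Y,Z$. Lifts: $\pi_i:M_1\times M_2\to M_i$ are the projections. For a function $\varphi$ on $M_1$ (resp. $M_2$), $\varphi^h=\varphi\circ\pi_1$ (resp. $\varphi^v=\varphi\circ\pi_2$). For $X_1\in\Gamma(TM_1)$, the horizontal lift $X_1^h$ is the vector field on $M_1\times M_2$ that is $\pi_1$-related to $X_1$ and $\pi_2$-related to $0$; for $X_2\in\Gamma(TM_2)$, the vertical lift $X_2^v$ is $\pi_2$-related to $X_2$ and $\pi_1$-related to $0$. Induced connection: let $\mathrm{grad} f_i$ be the gradient with respect to $g_i$, $b_1=g_1(\mathrm{grad} f_1,\mathrm{grad} f_1)$, and $H^{f_1}(X_1,Y_1)=X_1(Y_1(f_1))-(\overset{1}{\nabla}_{X_1}Y_1)(f_1)$ the Hessian of $f_1$ with respect to $\overset{1}{\nabla}$. The induced connection $\nabla$ on $M_1\times M_2$ is the affine connection determined on lifts, for $X_i,Y_i\in\Gamma(TM_i)$, by $$\nabla_{X_1^h}Y_1^h=(\overset{1}{\nabla}_{X_1}Y_1)^h+\frac{(cf_2^v)^2H^{f_1}(X_1,Y_1)^h}{1+(cf_2^v)^2b_1^h}(\mathrm{grad}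 f_1)^h-c^2f_2^v\,(X_1(\ln f_1)Y_1(\ln f_1))^h(\mathrm{grad} f_2)^v,$$ $$\nabla_{X_2^v}Y_2^v=(\overset{2}{\nabla}_{X_2}Y_2)^v-\frac{f_1^h\,g_2(X_2,Y_2)^v}{1+(cf_2^v)^2b_1^h}(\mathrm{grad} f_1)^h,$$ $$\nabla_{X_1^h}Y_2^v=\nabla_{Y_2^v}X_1^h=\frac{c^2f_2^v\,Y_2(f_2)^vX_1(f_1)^h}{1+(cf_2^v)^2b_1^h}(\mathrm{grad} f_1)^h+(X_1(\ln f_1))^hY_2^v.$$ *)

(* Defs.v *)
From HB Require Import structures.
From mathcomp Require Import all_boot all_order all_algebra.
From mathcomp Require Import all_classical all_reals all_analysis.

Set Implicit Arguments.
Unset Strict Implicit.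
Unset Printing Implicit Defensive.

Import Order.TTheory GRing.Theory Num.Theory.
Import numFieldNormedType.Exports.

Local Open Scope classical_set_scope.
Local Open Scope ring_scope.

Section smooth_on.
Context {R : realType} {n : nat}.
Implicit Types (U : set 'rV[R]_n) (f g : 'rV[R]_n -> R).

Definition unit_vec (i : 'I_n) : 'rV[R]_n := delta_mx 0 i.

Fixpoint Ck (k : nat) U f : Prop :=
  (forall x, U x -> {for x, continuous f}) /\
  if k is k'.+1 then
    forall i, (forall x, U x -> derivable f x (unit_vec i)) /\
              Ck k' U (fun x => 'D_(unit_vec i) f x)
  else True.

Definition smooth_on U f := forall k, Ck k U f.

Lemma near_open U f g x : open U -> (forall y, U y -> f y = g y) -> U x ->
  \forall y \near x, f y = g y.
Proof.
move=> oU fg Ux; have /= := open_nbhs_nbhs (conj oU Ux).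
by apply: filterS => y /fg.
Qed.

Lemma cont_ext U f g x : open U -> (forall y, U y -> f y = g y) -> U x ->
  {for x, continuous f} -> {for x, continuous g}.
Proof.
move=> oU fg Ux cf; have nfg := near_open oU fg Ux.
have h : f y @[y --> x] --> g x by rewrite -(fg x Ux); exact: cf.
by apply: cvg_trans h; exact: (@near_eq_cvg _ _ (nbhs x) _ f g nfg).
Qed.

Lemma Ck_ext k U f g : open U -> (forall y, U y -> f y = g y) ->
  Ck k U f -> Ck k U g.
Proof.
move=> oU; elim: k f g => [|k IHk] f g fg [cf df]; split.
- by move=> x Ux; apply: (cont_ext oU fg Ux); exact: cf.
- by [].
- by move=> x Ux; apply: (cont_ext oU fg Ux); exact: cf.
- move=> i; have [dfi Cfi] := df i; split.
    move=> x Ux; have nfg := near_open oU fg Ux.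
    by apply: near_eq_derivable (dfi x Ux).
  apply: IHk Cfi => y Uy; apply: near_eq_derive; exact: near_open Uy.
Qed.

Lemma Ck_cont k U f : Ck k U f -> forall x, U x -> {for x, continuous f}.
Proof. by case: k => [|k] []. Qed.

Lemma Ck_sub k U V f : U `<=` V -> Ck k V f -> Ck k U f.
Proof.
move=> UV; elim: k f => [|k IHk] f [cf df]; split=> //;
  try by move=> x /UV; exact: cf.
move=> i; have [dfi Cfi] := df i; split; last exact: IHk.
by move=> x /UV; exact: dfi.
Qed.

Lemma CkS k U f : Ck k.+1 U f -> Ck k U f.
Proof.
elim: k f => [|k IHk] f [cf df]; split=> // i.
by have [dfi Cfi] := df i; split=> //; exact: IHk.
Qed.

Lemma Ck_cst k U (c : R) : Ck k U (fun=> c).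
Proof.
elim: k c => [|k IHk] c; split=> //; try by move=> x _; exact: cst_continuous.
move=> i; split; first by move=> x _; exact: derivable_cst.
have -> : (fun x => 'D_(unit_vec i) (fun=> c) x) = fun=> 0.
  by apply/funext => x; exact: derive_cst.
exact: IHk.
Qed.

Lemma CkD k U f g : open U -> Ck k U f -> Ck k U g -> Ck k U (f + g).
Proof.
move=> oU; elim: k f g => [|k IHk] f g [cf df] [cg dg]; split=> //;
  try by move=> x Ux; apply: continuousD; [exact: cf|exact: cg].
move=> i; have [dfi Cfi] := df i; have [dgi Cgi] := dg i; split.
  by move=> x Ux; apply: derivableD; [exact: dfi|exact: dgi].
apply: Ck_ext (IHk _ _ Cfi Cgi) => // y Uy.
by rewrite deriveD; [|exact: dfi|exact: dgi].
Qed.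

Lemma CkM k U f g : open U -> Ck k U f -> Ck k U g -> Ck k U (f * g).
Proof.
move=> oU; elim: k f g => [|k IHk] f g Cf Cg.
  case: Cf Cg => [cf df] [cg dg]; split=> // x Ux.
  by apply: continuousM; [exact: cf|exact: cg].
have Cf' := CkS Cf; have Cg' := CkS Cg.
case: Cf Cg => [cf df] [cg dg]; split.
  by move=> x Ux; apply: continuousM; [exact: cf|exact: cg].
move=> i; have [dfi Cfi] := df i; have [dgi Cgi] := dg i; split.
  by move=> x Ux; apply: derivableM; [exact: dfi|exact: dgi].
apply: Ck_ext (CkD oU (IHk _ _ Cf' Cgi) (IHk _ _ Cg' Cfi)) => // y Uy.
by rewrite deriveM; [|exact: dfi|exact: dgi].
Qed.

End smooth_on.

Lemma derive0r (R : realType) n (f : 'rV[R]_n -> R) x : 'D_0 f x = 0.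
Proof.
rewrite /derive.
have -> : (fun h : R => h^-1 *: ((f \o shift x) (h *: 0) - f x)) = fun=> 0.
  by apply/funext => h /=; rewrite scaler0 add0r subrr scaler0.
by apply: cvg_lim; [exact: norm_hausdorff|exact: cvg_cst].
Qed.

Section smooth_proj.
Context {R : realType} {m n : nat}.
Variable L : {linear 'rV[R]_m -> 'rV[R]_n}.
Hypothesis cL : continuous L.
Hypothesis L_unit : forall i, (exists j, L (unit_vec i) = unit_vec j) \/
  L (unit_vec i) = 0.

Lemma derive_proj (f : 'rV[R]_n -> R) x v : 'D_v (f \o L) x = 'D_(L v) f (L x).
Proof.
rewrite /derive; set q := (q in lim (q @ _)); set q' := (q in _ = lim (q @ _)).
have -> // : q = q'.
by apply/funext => h; rewrite /q /q' /= linearP.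
Qed.

Lemma derivable_proj (f : 'rV[R]_n -> R) x v :
  derivable f (L x) (L v) -> derivable (f \o L) x v.
Proof.
rewrite /derivable; set q := (q in cvg (q @ _)).
set q' := (q in _ -> cvg (q @ _)).
have -> // : q' = q.
by apply/funext => h; rewrite /q /q' /= linearP.
Qed.

Lemma Ck_proj k U (f : 'rV[R]_n -> R) : Ck k U f -> Ck k (L @^-1` U) (f \o L).
Proof.
elim: k f => [|k IHk] f [cf df]; split=> //;
  try by move=> x Ux; apply: continuous_comp; [exact: cL|exact: cf].
move=> i; split.
  move=> x Ux; apply: derivable_proj.
  case: (L_unit i) => [[j ->]| ->]; last exact: derivable0.
  by have [dfj _] := df j; exact: dfj.
case: (L_unit i) => [[j Lj]| L0].
  have [_ Cfj] := df j.
  have -> : (fun x => 'D_(unit_vec i) (f \o L) x) =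
      (fun y => 'D_(unit_vec j) f y) \o L.
    by apply/funext => x; rewrite derive_proj Lj.
  exact: IHk.
have -> : (fun x => 'D_(unit_vec i) (f \o L) x) = fun=> 0.
  by apply/funext => x; rewrite derive_proj L0 derive0r.
exact: Ck_cst.
Qed.

End smooth_proj.

(* A chart is a homeomorphism from cdom onto ccod; cfun and cinv are          *)
(* arbitrary outside these open sets.                                         *)
Record chart (R : realType) (n : nat) (T : topologicalType) := Chart {
  cdom : set T;
  ccod : set 'rV[R]_n;
  cfun :> T -> 'rV[R]_n;
  cinv : 'rV[R]_n -> T;
  cdom_open : open cdom;
  ccod_open : open ccod;
  cfun_cod : forall p, cdom p -> ccod (cfun p);
  cinv_dom : forall x, ccod x -> cdom (cinv x);
  cfunK : forall p, cdom p -> cinv (cfun p) = p;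
  cinvK : forall x, ccod x -> cfun (cinv x) = x;
  cfun_cont : forall p, cdom p -> {for p, continuous cfun};
  cinv_cont : forall x, ccod x -> {for x, continuous cinv} }.

Record manifold (R : realType) (n : nat) := Manifold {
  mspace :> topologicalType;
  atlas : set (chart R n mspace);
  mspace_hausdorff : hausdorff_space mspace;
  mspace_second_countable : @second_countable mspace;
  mspace_nonempty : [set: mspace] !=set0;
  atlas_cover : forall p : mspace, exists2 a, atlas a & cdom a p;
  atlas_compat : forall a b, atlas a -> atlas b -> forall j,
    smooth_on (ccod a `&` cinv a @^-1` cdom b)
              (fun x => b (cinv a x) ord0 j) }.

Section prod_manifold.
Context {R : realType} {n1 n2 : nat}.

Lemma lsubmx_continuous : continuous (@lsubmx R 1 n1 n2).
Proof.
move=> x A [P Px sPA].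
exists (fun (i : 'I_1) (j : 'I_(n1 + n2)) =>
  match fintype.split j with inl j1 => P i j1 | inr _ => setT end).
  move=> i j; case: splitP => [j1 jE|_ _]; last exact: filterT.
  have := Px i j1; rewrite mxE (_ : lshift n2 j1 = j) //.
  exact/val_inj.
move=> y Py; apply: sPA => i j; rewrite mxE.
by have := Py i (lshift n2 j); rewrite (unsplitK (inl j)).
Qed.

Lemma rsubmx_continuous : continuous (@rsubmx R 1 n1 n2).
Proof.
move=> x A [P Px sPA].
exists (fun (i : 'I_1) (j : 'I_(n1 + n2)) =>
  match fintype.split j with inl _ => setT | inr j2 => P i j2 end).
  move=> i j; case: splitP => [_ _|j2 jE]; first exact: filterT.
  have := Px i j2; rewrite mxE (_ : rshift n1 j2 = j) //.
  exact/val_inj.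
move=> y Py; apply: sPA => i j; rewrite mxE.
by have := Py i (rshift n1 j); rewrite (unsplitK (inr j)).
Qed.

Lemma row_mx_continuous (T : topologicalType) (f : T -> 'rV[R]_n1)
    (g : T -> 'rV[R]_n2) p : {for p, continuous f} -> {for p, continuous g} ->
  {for p, continuous (fun q => row_mx (f q) (g q))}.
Proof.
move=> cf cg A [P Pp sPA].
have nf : nbhs (f p)
    [set x : 'rV[R]_n1 | forall i j, P i (lshift n2 j) (x i j)].
  exists (fun i j => P i (lshift n2 j)) => // i j.
  by have := Pp i (lshift n2 j); rewrite row_mxEl.
have ng : nbhs (g p)
    [set x : 'rV[R]_n2 | forall i j, P i (rshift n1 j) (x i j)].
  exists (fun i j => P i (rshift n1 j)) => // i j.
  by have := Pp i (rshift n1 j); rewrite row_mxEr.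
have nf' : nbhs p (f @^-1` [set x : 'rV[R]_n1 |
    forall i j, P i (lshift n2 j) (x i j)]) by exact: cf.
have ng' : nbhs p (g @^-1` [set x : 'rV[R]_n2 |
    forall i j, P i (rshift n1 j) (x i j)]) by exact: cg.
suff : nbhs p ((fun q => row_mx (f q) (g q)) @^-1` A) by [].
apply: filterS (filterI nf' ng') => q /= [hf hg].
apply: sPA => i j; rewrite mxE; case: splitP => k jk.
  by have -> : j = lshift n2 k by exact/val_inj.
by have -> : j = rshift n1 k by exact/val_inj.
Qed.

Lemma lsubmx_unit i :
  (exists j, lsubmx (unit_vec i : 'rV[R]_(n1 + n2)) = unit_vec j) \/
  lsubmx (unit_vec i : 'rV[R]_(n1 + n2)) = 0.
Proof.
case: (split_ordP i) => k ->.
  left; exists k; apply/rowP => j; rewrite !mxE !eqxx /=.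
  by rewrite (inj_eq (@lshift_inj _ _)).
by right; apply/rowP => j; rewrite !mxE eq_lrshift andbF.
Qed.

Lemma rsubmx_unit i :
  (exists j, rsubmx (unit_vec i : 'rV[R]_(n1 + n2)) = unit_vec j) \/
  rsubmx (unit_vec i : 'rV[R]_(n1 + n2)) = 0.
Proof.
case: (split_ordP i) => k ->.
  by right; apply/rowP => j; rewrite !mxE eq_rlshift andbF.
left; exists k; apply/rowP => j; rewrite !mxE !eqxx /=.
by rewrite (inj_eq (@rshift_inj _ _)).
Qed.

Lemma smooth_lsubmx U (f : 'rV[R]_n1 -> R) : smooth_on U f ->
  smooth_on (lsubmx @^-1` U : set 'rV[R]_(n1 + n2)) (f \o lsubmx).
Proof.
by move=> Uf k; apply: (Ck_proj lsubmx_continuous lsubmx_unit); exact: Uf.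
Qed.

Lemma smooth_rsubmx U (f : 'rV[R]_n2 -> R) : smooth_on U f ->
  smooth_on (rsubmx @^-1` U : set 'rV[R]_(n1 + n2)) (f \o rsubmx).
Proof.
by move=> Uf k; apply: (Ck_proj rsubmx_continuous rsubmx_unit); exact: Uf.
Qed.

Lemma openXP (T1 T2 : topologicalType) (A : set T1) (B : set T2) :
  open A -> open B -> open (A `*` B).
Proof.
move=> oA oB; rewrite openE => -[p q] [/= Ap Bq]; exists (A, B) => //=.
by split; exact: open_nbhs_nbhs.
Qed.

Section prod_chart.
Context {T1 T2 : topologicalType} (a : chart R n1 T1) (b : chart R n2 T2).

Let dom : set (T1 * T2) := cdom a `*` cdom b.
Let cod : set 'rV[R]_(n1 + n2) := lsubmx @^-1` ccod a `&` rsubmx @^-1` ccod b.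
Let phi (z : T1 * T2) : 'rV[R]_(n1 + n2) := row_mx (a z.1) (b z.2).
Let psi (x : 'rV[R]_(n1 + n2)) : T1 * T2 :=
  (cinv a (lsubmx x), cinv b (rsubmx x)).

Let dom_open : open dom.
Proof. by apply: openXP; exact: cdom_open. Qed.

Let cod_open : open cod.
Proof.
apply: openI.
- by apply: open_comp => [x _|]; [exact: lsubmx_continuous|exact: ccod_open].
- by apply: open_comp => [x _|]; [exact: rsubmx_continuous|exact: ccod_open].
Qed.

Let phi_cod z : dom z -> cod (phi z).
Proof.
move=> [d1 d2]; split; rewrite /= /phi ?row_mxKl ?row_mxKr; exact: cfun_cod.
Qed.

Let psi_dom x : cod x -> dom (psi x).
Proof. by move=> [c1 c2]; split; exact: cinv_dom. Qed.

Let phiK z : dom z -> psi (phi z) = z.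
Proof.
case: z => p q [/= d1 d2].
by rewrite /psi /phi row_mxKl row_mxKr /= !cfunK.
Qed.

Let psiK x : cod x -> phi (psi x) = x.
Proof. by move=> [c1 c2]; rewrite /phi /psi /= !cinvK// hsubmxK. Qed.

Let phi_cont z : dom z -> {for z, continuous phi}.
Proof.
move=> [d1 d2]; apply: row_mx_continuous.
  by apply: (@continuous_comp _ _ _ fst a); [exact: cvg_fst|exact: cfun_cont].
by apply: (@continuous_comp _ _ _ snd b); [exact: cvg_snd|exact: cfun_cont].
Qed.

Let psi_cont x : cod x -> {for x, continuous psi}.
Proof.
move=> [c1 c2].
have h1 : {for x, continuous (cinv a \o lsubmx)}.
  by apply: continuous_comp; [exact: lsubmx_continuous|exact: cinv_cont].
have h2 : {for x, continuous (cinv b \o rsubmx)}.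
  by apply: continuous_comp; [exact: rsubmx_continuous|exact: cinv_cont].
exact: cvg_pair h1 h2.
Qed.

Definition prod_chart : chart R (n1 + n2) (T1 * T2)%type :=
  Chart dom_open cod_open phi_cod psi_dom phiK psiK phi_cont psi_cont.

End prod_chart.

Variables (M1 : manifold R n1) (M2 : manifold R n2).

Definition prod_atlas : set (chart R (n1 + n2) (M1 * M2)%type) :=
  [set prod_chart a b | a in atlas (m := M1) & b in atlas (m := M2)].

Lemma prod_hausdorff : hausdorff_space (M1 * M2)%type.
Proof.
move=> [p1 p2] [q1 q2] pq; congr pair.
  apply: (@mspace_hausdorff _ _ M1) => A B Ap Bq.
  have [||[x y] [/= Ax Bx]] := pq (A `*` setT) (B `*` setT).
  - by exists (A, setT) => //; split=> //; exact: filterT.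
  - by exists (B, setT) => //; split=> //; exact: filterT.
  - by exists x; split; [case: Ax|case: Bx].
apply: (@mspace_hausdorff _ _ M2) => A B Ap Bq.
have [||[x y] [/= Ay By]] := pq (setT `*` A) (setT `*` B).
- by exists (setT, A) => //; split=> //; exact: filterT.
- by exists (setT, B) => //; split=> //; exact: filterT.
- by exists y; split; [case: Ay|case: By].
Qed.

Lemma prod_second_countable : @second_countable (M1 * M2)%type.
Proof.
have [B1 cB1 [oB1 bB1]] := @mspace_second_countable _ _ M1.
have [B2 cB2 [oB2 bB2]] := @mspace_second_countable _ _ M2.
exists [set A `*` B | A in B1 & B in B2].
  rewrite image2E; apply: sub_countable (card_image_le _ _) _.
  exact: countableX.
split.
  by move=> _ [A B1A [B B2B <-]]; apply: openXP; [exact: oB1|exact: oB2].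
move=> [p q] C [[A B] /= [Ap Bq] sC].
have [A' [B1A' A'p] sA] := bB1 p A Ap; have [B' [B2B' B'q] sB] := bB2 q B Bq.
exists (A' `*` B'); first by split=> //; exists A' => //; exists B'.
by move=> [x y] [/= /sA Ax /sB By]; exact: sC.
Qed.

Lemma prod_nonempty : [set: (M1 * M2)%type] !=set0.
Proof.
have [p _] := @mspace_nonempty _ _ M1; have [q _] := @mspace_nonempty _ _ M2.
by exists (p, q).
Qed.

Lemma prod_cover (z : M1 * M2) : exists2 a, prod_atlas a & cdom a z.
Proof.
have [a Aa az] := atlas_cover z.1; have [b Ab bz] := atlas_cover z.2.
by exists (prod_chart a b) => //; exists a => //; exists b.
Qed.

Lemma prod_compat (c d : chart R (n1 + n2) (M1 * M2)%type) :
  prod_atlas c -> prod_atlas d -> forall j,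
  smooth_on (ccod c `&` cinv c @^-1` cdom d)
            (fun x => d (cinv c x) ord0 j).
Proof.
move=> [a Aa [b Ab <-]] [a' Aa' [b' Ab' <-]] j.
set U := _ `&` _.
case: (split_ordP j) => i ->.
  have -> : (fun x => prod_chart a' b' (cinv (prod_chart a b) x) ord0
      (lshift n2 i)) = (fun x => a' (cinv a x) ord0 i) \o lsubmx.
    by apply/funext => x /=; rewrite row_mxEl.
  move=> k; apply: Ck_sub (smooth_lsubmx (atlas_compat Aa Aa' i) k).
  by move=> x [[/= c1 c2] [/= d1 d2]].
have -> : (fun x => prod_chart a' b' (cinv (prod_chart a b) x) ord0
    (rshift n1 i)) = (fun x => b' (cinv b x) ord0 i) \o rsubmx.
  by apply/funext => x /=; rewrite row_mxEr.
move=> k; apply: Ck_sub (smooth_rsubmx (atlas_compat Ab Ab' i) k).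
by move=> x [[/= c1 c2] [/= d1 d2]].
Qed.

Definition prod_manifold : manifold R (n1 + n2) :=
  Manifold prod_hausdorff prod_second_countable prod_nonempty
           prod_cover prod_compat.

End prod_manifold.

Section smooth.
Context {R : realType} {n : nat} {M : manifold R n}.

Definition smooth (f : M -> R) : Prop :=
  forall a, atlas a -> smooth_on (ccod a) (f \o cinv a).

Lemma smooth_cst c : smooth (fun=> c).
Proof. by move=> a _ k; exact: Ck_cst. Qed.

Lemma smoothD f g : smooth f -> smooth g -> smooth (f + g).
Proof.
by move=> sf sg a Aa k; apply: CkD; [exact: ccod_open|exact: sf|exact: sg].
Qed.

Lemma smoothM f g : smooth f -> smooth g -> smooth (f * g).
Proof.
by move=> sf sg a Aa k; apply: CkM; [exact: ccod_open|exact: sf|exact: sg].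
Qed.

End smooth.

(* The tangent space at p is the span of the coordinate derivations d/dx_i at *)
(* p, as functionals on the smooth functions; requiring this form in every    *)
(* chart at p, or in one of them, is the same. Functionals are totalized by 0 *)
(* on the functions that are not smooth, so that equality of tangent vectors  *)
(* is Leibniz equality.                                                       *)
Section tangent.
Context {R : realType} {n : nat} {M : manifold R n}.

Definition is_tangent (p : M) (v : (M -> R) -> R) : Prop :=
  (forall a, atlas a -> cdom a p -> exists w : 'rV[R]_n, forall f, smooth f ->
    v f = \sum_i w ord0 i * 'D_(unit_vec i) (f \o cinv a) (a p)) /\
  (forall f, ~ smooth f -> v f = 0).

Record tangent (p : M) := Tangent {
  tangent_fun :> (M -> R) -> R;
  tangentP : is_tangent p tangent_fun }.

Lemma tangent_ext p (u v : tangent p) :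
  (forall f, smooth f -> u f = v f) -> u = v.
Proof.
case: u v => [u Pu] [v Pv] /= uv.
have e : u = v.
  apply/funext => f; have [sf|nsf] := pselect (smooth f); first exact: uv.
  by rewrite Pu.2// Pv.2.
by subst v; congr Tangent; exact: Prop_irrelevance.
Qed.

Section ops.
Variable p : M.
Implicit Types u v : tangent p.

Lemma is_tangent0 : is_tangent p (fun=> 0).
Proof.
split=> // a Aa ap; exists 0 => f sf.
by rewrite big1// => i _; rewrite mxE mul0r.
Qed.

Lemma is_tangentD u v : is_tangent p (fun f => u f + v f).
Proof.
case: u v => [u Pu] [v Pv] /=; split=> [a Aa ap|f nf]; last first.
  by rewrite Pu.2// Pv.2// addr0.
have [w uE] := Pu.1 a Aa ap; have [w' vE] := Pv.1 a Aa ap.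
exists (w + w') => f sf; rewrite uE// vE// -big_split.
by apply: eq_bigr => i _; rewrite mxE mulrDl.
Qed.

Lemma is_tangentZ c u : is_tangent p (fun f => c * u f).
Proof.
case: u => [u Pu] /=; split=> [a Aa ap|f nf]; last first.
  by rewrite Pu.2// mulr0.
have [w uE] := Pu.1 a Aa ap; exists (c *: w) => f sf.
by rewrite uE// mulr_sumr; apply: eq_bigr => i _; rewrite mxE mulrA.
Qed.

Definition tangent0 := Tangent is_tangent0.
Definition tangent_add u v := Tangent (is_tangentD u v).
Definition tangent_scale c u := Tangent (is_tangentZ c u).
Definition tangent_opp u := tangent_scale (-1) u.

Lemma tangent_addA : associative tangent_add.
Proof. by move=> u v w; apply: tangent_ext => f _ /=; rewrite addrA. Qed.

Lemma tangent_addC : commutative tangent_add.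
Proof. by move=> u v; apply: tangent_ext => f _ /=; rewrite addrC. Qed.

Lemma tangent_add0 : left_id tangent0 tangent_add.
Proof. by move=> u; apply: tangent_ext => f _ /=; rewrite add0r. Qed.

Lemma tangent_addN : left_inverse tangent0 tangent_opp tangent_add.
Proof. by move=> u; apply: tangent_ext => f _ /=; rewrite mulN1r addNr. Qed.

HB.instance Definition _ := gen_eqMixin (tangent p).
HB.instance Definition _ := gen_choiceMixin (tangent p).
HB.instance Definition _ := GRing.isZmodule.Build (tangent p)
  tangent_addA tangent_addC tangent_add0 tangent_addN.

Lemma tangent_scaleA c d u :
  tangent_scale c (tangent_scale d u) = tangent_scale (c * d) u.
Proof. by apply: tangent_ext => f _ /=; rewrite mulrA. Qed.

Lemma tangent_scale1 : left_id 1 tangent_scale.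
Proof. by move=> u; apply: tangent_ext => f _ /=; rewrite mul1r. Qed.

Lemma tangent_scaleDr : right_distributive tangent_scale +%R.
Proof. by move=> c u v; apply: tangent_ext => f _ /=; rewrite mulrDr. Qed.

Lemma tangent_scaleDl u : {morph tangent_scale^~ u : c d / c + d}.
Proof. by move=> c d; apply: tangent_ext => f _ /=; rewrite mulrDl. Qed.

HB.instance Definition _ := GRing.Zmodule_isLmodule.Build R (tangent p)
  tangent_scaleA tangent_scale1 tangent_scaleDr tangent_scaleDl.

End ops.
End tangent.

Section vfield.
Context {R : realType} {n : nat} {M : manifold R n}.

Record vfield := VField {
  vfield_fun :> forall p : M, tangent p;
  vfieldP : forall f, smooth f -> smooth (fun p => vfield_fun p f) }.

Definition dirder (X : vfield) (f : M -> R) : M -> R := fun p => X p f.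

Lemma vfield_ext (X Y : vfield) : (forall p, X p = Y p) -> X = Y.
Proof.
case: X Y => [X PX] [Y PY] /= XY.
have e : X = Y by exact: functional_extensionality_dep.
by subst Y; congr VField; exact: Prop_irrelevance.
Qed.

Lemma vfield0_subproof f : smooth f -> smooth (fun p : M => (0 : tangent p) f).
Proof. by move=> _; exact: smooth_cst. Qed.

Definition vfield0 := VField vfield0_subproof.

Lemma vfield_add_subproof (X Y : vfield) f : smooth f ->
  smooth (fun p => (X p + Y p) f).
Proof. by move=> sf; exact: (smoothD (vfieldP X sf) (vfieldP Y sf)). Qed.

Definition vfield_add X Y := VField (vfield_add_subproof X Y).

Lemma vfield_scale_subproof h (sh : smooth h) (X : vfield) f : smooth f ->
  smooth (fun p => (h p *: X p) f).
Proof. by move=> sf; exact: (smoothM sh (vfieldP X sf)). Qed.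

Definition vfield_scale h (sh : smooth h) X :=
  VField (vfield_scale_subproof sh X).

HB.instance Definition _ := gen_eqMixin vfield.
HB.instance Definition _ := gen_choiceMixin vfield.

End vfield.
Arguments vfield {R n} M.

Section geometry.
Context {R : realType} {n : nat} (M : manifold R n).

Record connection := Connection {
  nabla :> vfield M -> vfield M -> vfield M;
  nablaDl : forall X Y Z p,
    nabla (vfield_add X Y) Z p = nabla X Z p + nabla Y Z p;
  nablaZl : forall f (sf : smooth f) X Y p,
    nabla (vfield_scale sf X) Y p = f p *: nabla X Y p;
  nablaDr : forall X Y Z p,
    nabla X (vfield_add Y Z) p = nabla X Y p + nabla X Z p;
  nabla_leibniz : forall f (sf : smooth f) X Y p,
    nabla X (vfield_scale sf Y) p = X p f *: Y p + f p *: nabla X Y p }.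

Record riemannian := Riemannian {
  metric :> forall p : M, tangent p -> tangent p -> R;
  metric_linear : forall p c (u v w : tangent p),
    metric (c *: u + v) w = c * metric u w + metric v w;
  metric_sym : forall p (u v : tangent p), metric u v = metric v u;
  metric_pos : forall p (u : tangent p), u != 0 -> 0 < metric u u;
  metric_smooth : forall X Y : vfield M, smooth (fun p => metric (X p) (Y p)) }.

Definition metric_fun (g : riemannian) (X Y : vfield M) : M -> R :=
  fun p => g p (X p) (Y p).

(* Vector fields are determined by their action on smooth functions; the      *)
(* bracket is given as an operator on functions.                              *)
Definition lie_bracket (X Y : vfield M) (f : M -> R) : M -> R :=
  dirder X (dirder Y f) - dirder Y (dirder X f).

Definition torsion_free (D : connection) : Prop :=
  forall X Y f, smooth f ->
    dirder (D X Y) f - dirder (D Y X) f = lie_bracket X Y f.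

Definition nabla_metric (D : connection) (g : riemannian) (X Y Z : vfield M) :
    M -> R :=
  dirder X (metric_fun g Y Z) - metric_fun g (D X Y) Z - metric_fun g Y (D X Z).

Definition statistical_manifold (D : connection) (g : riemannian) : Prop :=
  torsion_free D /\
  forall X Y Z, nabla_metric D g X Y Z = nabla_metric D g Y X Z.

Definition is_gradient (g : riemannian) (f : M -> R) (G : vfield M) : Prop :=
  forall p (u : tangent p), g p (G p) u = u f.

Definition hessian (D : connection) (f : M -> R) (X Y : vfield M) : M -> R :=
  dirder X (dirder Y f) - dirder (D X Y) f.

End geometry.

Section product.
Context {R : realType} {n1 n2 : nat}.
Context {M1 : manifold R n1} {M2 : manifold R n2}.
Local Notation M := (prod_manifold M1 M2).

Definition hfun (f : M1 -> R) : M -> R := fun z => f z.1.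
Definition vfun (f : M2 -> R) : M -> R := fun z => f z.2.

Lemma smooth_hfun f : smooth f -> smooth (hfun f).
Proof.
move=> sf c Ac k; have [a Aa [b Ab cE]] := Ac; rewrite -{}cE {c Ac}.
have -> : hfun f \o cinv (prod_chart a b) = (f \o cinv a) \o lsubmx by [].
have := smooth_lsubmx (n2 := n2) (sf a Aa) k; apply: Ck_sub.
by move=> x [].
Qed.

Lemma smooth_vfun f : smooth f -> smooth (vfun f).
Proof.
move=> sf c Ac k; have [a Aa [b Ab cE]] := Ac; rewrite -{}cE {c Ac}.
have -> : vfun f \o cinv (prod_chart a b) = (f \o cinv b) \o rsubmx by [].
have := smooth_rsubmx (n1 := n1) (sf b Ab) k; apply: Ck_sub.
by move=> x [].
Qed.

Section diff.
Variables (z : M) (u : tangent z).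

Lemma is_tangent_dfst : is_tangent (z.1 : M1)
  (fun f => if `[<smooth f>] then u (hfun f) else 0).
Proof.
split=> [a Aa az|f nf]; last by rewrite asboolF.
have [b Ab bz] := atlas_cover z.2.
have Aab : atlas (prod_chart a b : chart R _ M) by exists a => //; exists b.
have [w uE] := (tangentP u).1 _ Aab (conj az bz).
exists (lsubmx w) => f sf; rewrite asboolT //.
rewrite uE; last exact: smooth_hfun.
have -> : hfun f \o cinv (prod_chart a b) = (f \o cinv a) \o lsubmx by [].
rewrite big_split_ord /= [X in _ + X]big1 ?addr0; last first.
  move=> i _; rewrite derive_proj /=.
  have -> : lsubmx (unit_vec (rshift n1 i) : 'rV[R]_(n1 + n2)) = 0.
    by apply/rowP => j; rewrite !mxE eq_lrshift andbF.
  by rewrite derive0r mulr0.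
apply: eq_bigr => i _; rewrite derive_proj /= row_mxKl.
have -> : lsubmx (unit_vec (lshift n2 i) : 'rV[R]_(n1 + n2)) = unit_vec i.
  by apply/rowP => j; rewrite !mxE (inj_eq (@lshift_inj _ _)).
by rewrite mxE.
Qed.

Lemma is_tangent_dsnd : is_tangent (z.2 : M2)
  (fun f => if `[<smooth f>] then u (vfun f) else 0).
Proof.
split=> [b Ab bz|f nf]; last by rewrite asboolF.
have [a Aa az] := atlas_cover z.1.
have Aab : atlas (prod_chart a b : chart R _ M) by exists a => //; exists b.
have [w uE] := (tangentP u).1 _ Aab (conj az bz).
exists (rsubmx w) => f sf; rewrite asboolT //.
rewrite uE; last exact: smooth_vfun.
have -> : vfun f \o cinv (prod_chart a b) = (f \o cinv b) \o rsubmx by [].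
rewrite big_split_ord /= [X in X + _]big1 ?add0r; last first.
  move=> i _; rewrite derive_proj /=.
  have -> : rsubmx (unit_vec (lshift n2 i) : 'rV[R]_(n1 + n2)) = 0.
    by apply/rowP => j; rewrite !mxE eq_rlshift andbF.
  by rewrite derive0r mulr0.
apply: eq_bigr => i _; rewrite derive_proj /= row_mxKr.
have -> : rsubmx (unit_vec (rshift n1 i) : 'rV[R]_(n1 + n2)) = unit_vec i.
  by apply/rowP => j; rewrite !mxE (inj_eq (@rshift_inj _ _)).
by rewrite mxE.
Qed.

Definition dfst : tangent (z.1 : M1) := Tangent is_tangent_dfst.
Definition dsnd : tangent (z.2 : M2) := Tangent is_tangent_dsnd.

End diff.

(* The field which is related to X1 by the first projection and to 0 by the   *)
(* second one. It exists and is unique, so that the default is never used.    *)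
Definition hlift (X1 : vfield M1) : vfield M :=
  xget vfield0 [set X : vfield M |
    forall z, dfst (X z) = X1 z.1 /\ dsnd (X z) = 0].

Definition vlift (X2 : vfield M2) : vfield M :=
  xget vfield0 [set X : vfield M |
    forall z, dfst (X z) = 0 /\ dsnd (X z) = X2 z.2].

End product.

Section induced.
Context {R : realType} {n1 n2 : nat}.
Context {M1 : manifold R n1} {M2 : manifold R n2}.
Local Notation M := (prod_manifold M1 M2).
Variables (c : R) (g1 : riemannian M1) (g2 : riemannian M2).
Variables (f1 : M1 -> R) (f2 : M2 -> R).

Definition warped_metric (z : M) (u v : tangent z) : R :=
  g1 z.1 (dfst u) (dfst v) + hfun f1 z ^+ 2 * g2 z.2 (dsnd u) (dsnd v) +
  c ^+ 2 * vfun f2 z ^+ 2 * (u (hfun f1) * v (hfun f1)).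

(* G1 and G2 are meant to be the gradients of f1 and f2, see is_gradient.     *)
Definition induced_connection (G1 : vfield M1) (G2 : vfield M2)
    (D1 : connection M1) (D2 : connection M2) (D : connection M) : Prop :=
  let b1 := metric_fun g1 G1 G1 in
  let k (z : M) := 1 + (c * vfun f2 z) ^+ 2 * hfun b1 z in
  let mixed (X1 : vfield M1) (Y2 : vfield M2) (z : M) : tangent z :=
    (c ^+ 2 * vfun f2 z * vfun (dirder Y2 f2) z * hfun (dirder X1 f1) z / k z)
      *: hlift G1 z +
    hfun (dirder X1 (@ln R \o f1)) z *: vlift Y2 z in
  [/\ forall (X1 Y1 : vfield M1) (z : M),
        D (hlift X1) (hlift Y1) z =
        hlift (D1 X1 Y1) z +
        ((c * vfun f2 z) ^+ 2 * hfun (hessian D1 f1 X1 Y1) z / k z)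
          *: hlift G1 z -
        (c ^+ 2 * vfun f2 z *
         hfun (dirder X1 (@ln R \o f1) * dirder Y1 (@ln R \o f1)) z)
          *: vlift G2 z,
      forall (X2 Y2 : vfield M2) (z : M),
        D (vlift X2) (vlift Y2) z =
        vlift (D2 X2 Y2) z -
        (hfun f1 z * vfun (metric_fun g2 X2 Y2) z / k z) *: hlift G1 z,
      forall (X1 : vfield M1) (Y2 : vfield M2) (z : M),
        D (hlift X1) (vlift Y2) z = mixed X1 Y2 z &
      forall (X1 : vfield M1) (Y2 : vfield M2) (z : M),
        D (vlift Y2) (hlift X1) z = mixed X1 Y2 z].

End induced.

(* Main.v *)
(**
Every tangent vector of the product is the value of a sum of a horizontal and a
vertical lift, and the torsion and the covariant derivative of the metric are
tensorial: their values at a point depend only on the values of the fields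
there (multiply a field by the cube of a bump function to write it globally in
terms of coordinate fields). So both conditions need only be checked on lifts.
There (nabla g)(X^h, Y^h, Z^h) = (nabla^1 g_1)(X, Y, Z)^h and
(nabla g)(X^v, Y^v, Z^v) = (f_1^h)^2 (nabla^2 g_2)(X, Y, Z)^v, while all mixed
components vanish. With T^i the torsion of nabla^i and
k = 1 + (c f_2)^2 b_1, the torsion on horizontal lifts is
T^1 - (c f_2)^2 / k * T^1(f_1) grad f_1, on vertical lifts it is T^2, and on
mixed lifts it is zero. If the first expression vanishes, applying it to f_1
gives T^1(f_1) / k = 0, hence T^1 = 0.
*)

Require Import Defs.
From HB Require Import structures.
From mathcomp Require Import all_boot all_order all_algebra.
From mathcomp Require Import all_classical all_reals all_analysis.
From mathcomp Require Import ring lra.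

Set Implicit Arguments.
Unset Strict Implicit.
Unset Printing Implicit Defensive.

Import Order.TTheory GRing.Theory Num.Theory.
Import numFieldNormedType.Exports.

Local Open Scope classical_set_scope.
Local Open Scope ring_scope.

(** * Mean value theorem and differentiability of C1 functions *)

(** The coefficients of the induced connection rest on one identity: as g1(grad f1, Z) = Z(f1), the
    warped metric satisfies g(grad f1^h, Z^h) = k Z(f1)^h. Division by k thus turns grad f1^h into
    the dual of df1^h, and every component of nabla g becomes a cancellation of a few terms. The
    length has other causes. A tangent vector must be a combination of partial derivatives in every
    chart, so even coordinate vectors need the chain rule, whereas [smooth_on] speaks of partial
    derivatives only; hence the differentiability of C1 functions. A vector field is known through
    its action on global smooth functions, so coordinates and coordinate fields must be cut off,
    with bump functions built from exp(-1/t). Lifts are chosen by [xget], so they have to be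
    constructed, and their smoothness requires smooth local coefficients of a field. Vanishing
    torsion on mixed lifts also requires that these lifts commute on every smooth function of the
    product. *)

Section mean_value.
Context {R : realType} {V : normedModType R}.
Implicit Types (f : V -> R) (x v : V).

Lemma is_derive_line f x v (t : R) : derivable f (t *: v + x) v ->
  is_derive t 1 (fun s : R => f (s *: v + x)) ('D_v f (t *: v + x)).
Proof.
move=> df.
have E : (fun h : R => h^-1 *: (((fun s : R => f (s *: v + x)) \o shift t)
    (h *: 1) - f (t *: v + x))) =
    (fun h => h^-1 *: ((f \o shift (t *: v + x)) (h *: v) - f (t *: v + x))).
  by apply/funext => h /=; rewrite [h *: 1]mulr1 scalerDl addrA.
by split; rewrite /derivable /derive /= E.
Qed.

Lemma mvt_line f x v (t : R) :
  (forall s : R, `|s| <= `|t| -> derivable f (s *: v + x) v) ->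
  exists2 s, `|s| <= `|t| & f (t *: v + x) - f x = 'D_v f (s *: v + x) * t.
Proof.
move=> df; pose g (s : R) := f (s *: v + x).
have dg (s : R) : `|s| <= `|t| -> is_derive s 1 g ('D_v f (s *: v + x)).
  by move=> /df; exact: is_derive_line.
have cg (a b : R) : (forall s : R, s \in `[a, b] -> `|s| <= `|t|) ->
    {within `[a, b], continuous g}.
  move=> st; apply: derivable_within_continuous => s /st /dg ds.
  exact: ex_derive.
have [t0|t0] := leP 0 t.
  have st (s : R) : s \in `[0, t] -> `|s| <= `|t|.
    by rewrite in_itv /= => /andP[s0 st]; rewrite !ger0_norm.
  have [|||s /st ? E] := @MVT_segment _ g (fun s => 'D_v f (s *: v + x)) 0 t => //.
    by move=> s s0t; apply/dg/st; apply: subset_itv_oo_cc.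
    exact: cg.
  by exists s => //; move: E; rewrite /g scale0r add0r subr0.
have st (s : R) : s \in `[t, 0] -> `|s| <= `|t|.
  rewrite in_itv /= => /andP[s0 st].
  by rewrite !ler0_norm ?lerN2 // ltW.
have [|||s /st ? E] := @MVT_segment _ g (fun s => 'D_v f (s *: v + x)) t 0 => //.
  exact: ltW.
  by move=> s s0t; apply/dg/st; apply: subset_itv_oo_cc.
  exact: cg.
exists s => //; move: E; rewrite /g scale0r add0r sub0r mulrN => /eqP.
by rewrite -eqr_oppLR opprB => /eqP.
Qed.

End mean_value.

Section differentiable_Ck.
Context {R : realType} {n : nat}.
Implicit Types (U : set 'rV[R]_n) (f : 'rV[R]_n -> R) (x : 'rV[R]_n).

Lemma coord_le_norm x j : `|x ord0 j| <= `|x|.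
Proof.
rewrite [leRHS]/Num.Def.normr /= mx_normrE.
exact: (le_bigmax _ (fun ij => `|x ij.1 ij.2|) (ord0, j)).
Qed.

Lemma norm_le_coord x (e : R) :
  0 <= e -> (forall j, `|x ord0 j| <= e) -> `|x| <= e.
Proof.
move=> e0 xe; rewrite [leLHS]/Num.Def.normr /= mx_normrE.
by apply: bigmax_le => // -[i j] _ /=; rewrite ord1.
Qed.

(** Walk from [x] to [h + x] changing one coordinate at a time: [z k] has received the first [k]
    coordinates of [h]. Each step is a one-variable mean value theorem. All intermediate points stay
    within [|h|] of [x] because the norm is the maximum of the coordinates. *)
Lemma mvt_telescope f x h :
  (forall y j, `|y - x| <= `|h| -> derivable f y (unit_vec j)) ->
  exists2 xi : 'I_n -> 'rV[R]_n, (forall j, `|xi j - x| <= `|h|) &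
    f (h + x) - f x = \sum_j 'D_(unit_vec j) f (xi j) * h ord0 j.
Proof.
move=> df.
pose z (k : nat) : 'rV[R]_n := \row_j (if (j < k)%N then h ord0 j else 0) + x.
have zS (k : 'I_n) : z k.+1 = h ord0 k *: unit_vec k + z k.
  apply/rowP => j; rewrite !mxE eqxx /= addrA; congr (_ + _).
  rewrite ltnS leq_eqVlt -val_eqE /=; case: (ltngtP j k) => //= jk;
    rewrite ?mulr0 ?add0r// mulr1 addr0.
  by congr (h _ _); exact/val_inj.
have zb (k : 'I_n) s : `|s| <= `|h ord0 k| ->
    `|s *: unit_vec k + z k - x| <= `|h|.
  move=> sh; apply: norm_le_coord => // j; rewrite !mxE eqxx /= addrA addrK.
  rewrite -val_eqE /=; case: (ltngtP j k) => //= jk.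
  - by rewrite mulr0 add0r coord_le_norm.
  - by rewrite mulr0 add0r normr0.
  - by rewrite mulr1 addr0; apply: le_trans sh (coord_le_norm _ _).
have /choice[s sE] : forall k : 'I_n, exists s, `|s| <= `|h ord0 k| /\
    f (z k.+1) - f (z k) =
    'D_(unit_vec k) f (s *: unit_vec k + z k) * h ord0 k.
  move=> k; have [|s sh E] := @mvt_line _ _ f (z k) (unit_vec k) (h ord0 k).
    by move=> s /zb; exact: df.
  by exists s; rewrite zS.
exists (fun k => s k *: unit_vec k + z k).
  by move=> j; apply: zb; exact: (sE j).1.
under eq_bigr do rewrite -(sE _).2.
rewrite -(big_mkord xpredT (fun k => f (z k.+1) - f (z k))) telescope_sumr //.
by congr (f _ - f _); apply/rowP => j; rewrite !mxE ?ltn_ord// add0r.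
Qed.

(** After telescoping, the error of the linear approximation is a sum of terms (partial at [xi j]
    minus partial at [x]) times [h_j], and continuity of the partial derivatives makes it o(h). *)
Lemma differentiable_Ck U f x : open U -> U x -> Ck 1 U f ->
  differentiable f x /\
  forall v, 'd f x v = \sum_j v ord0 j * 'D_(unit_vec j) f x.
Proof.
move=> oU Ux [_ df].
pose L (v : 'rV[R]_n) : R := \sum_j v ord0 j * 'D_(unit_vec j) f x.
have L_lin : linear L.
  move=> a u v; rewrite /L scaler_sumr -big_split; apply: eq_bigr => j _ /=.
  by rewrite !mxE mulrDl -mulrA.
pose LL : {linear 'rV[R]_n -> R} := HB.pack L (GRing.isLinear.Build _ _ _ _ _ L_lin).
have cL : continuous L.
  move=> v; apply: (@cvg_big R _ +%R 0 xpredT _ _ (nbhs v)) => [|j _].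
    exact: add_continuous.
  by apply: cvgM; [exact: coord_continuous|exact: cvg_cst].
have dE : (f : 'rV[R]_n -> R^o) \o shift x =
    cst (f x) + (L : 'rV[R]_n -> R^o) +o_ (0 : 'rV[R]_n) id.
  apply/eqaddoP => e e0.
  (* The error is spread over [n] terms; the divisor [n.+1] also covers [n = 0]. *)
  have e'0 : 0 < e / n.+1%:R by rewrite divr_gt0.
  have cdf j : \forall y \near x,
      `|'D_(unit_vec j) f x - 'D_(unit_vec j) f y| <= e / n.+1%:R.
    by have /cvgrPdist_le := (df j).2.1 x Ux; exact.
  have : \forall y \near x, U y /\ forall j,
      `|'D_(unit_vec j) f x - 'D_(unit_vec j) f y| <= e / n.+1%:R.
    apply: (@filterI _ (nbhs x)); first exact: open_nbhs_nbhs.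
    exact: filter_forall cdf.
  case/nbhs_normP => d /= d0 dP.
  near=> h.
  have hd : `|h| < d by near: h; apply/(@nbhs_norm0P R 'rV[R]_n); exists d.
  have yd y : `|y - x| <= `|h| -> `|x - y| < d.
    by rewrite distrC => /le_lt_trans; exact.
  have [|xi xih E] := @mvt_telescope f x h.
    by move=> y j /yd /dP[Uy _]; apply: (df j).1.
  rewrite !fctE /= (_ : _ - _ = \sum_j
      ('D_(unit_vec j) f (xi j) - 'D_(unit_vec j) f x) * h ord0 j); last first.
    rewrite opprD addrA E /L /= -sumrB.
    by apply: eq_bigr => j _; rewrite mulrBl [h _ _ * _]mulrC.
  apply: le_trans (ler_norm_sum _ _ _) _.
  apply: (@le_trans _ _ (\sum_(j < n) (e / n.+1%:R * `|h|))).
    apply: ler_sum => j _; rewrite normrM; apply: ler_pM => //.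
      by rewrite distrC; apply: (dP _ (yd _ (xih j))).2.
    exact: coord_le_norm.
  rewrite sumr_const card_ord -mulrnAl ler_wpM2r//.
  rewrite -mulr_natr -mulrA ler_piMr ?(ltW e0)//.
  by rewrite ler_pdivrMl// mulr1 ler_nat.
have dL := @diff_unique _ _ _ f LL x cL dE.
split; last by move=> v; rewrite dL.
by apply/diff_locallyP; rewrite dL.
Unshelve. all: by end_near. Qed.

(** [F] is derivable only in the direction [v], so it is replaced by the curve [F (s *: v + x)],
    which is differentiable at 0; the chain rule for differentials applies to [f] along this
    curve. *)
Lemma chain_rule (V : normedModType R) U f (F : V -> 'rV[R]_n) (x v : V) :
  open U -> Ck 1 U f -> U (F x) ->
  (forall j, derivable (fun y => F y ord0 j) x v) ->
  is_derive x v (f \o F)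
    (\sum_j 'D_v (fun y => F y ord0 j) x * 'D_(unit_vec j) f (F x)).
Proof.
move=> oU C1f UFx dF.
have dFv : derivable F x v by apply/derivable_mxP => i j; rewrite ord1.
have dl : is_derive (0 : R) 1 (fun s : R => F (s *: v + x)) ('D_v F x).
  have E : (fun h : R => h^-1 *: (((fun s : R => F (s *: v + x)) \o shift (0 : R))
      (h *: 1) - F (0 *: v + x))) =
      (fun h => h^-1 *: ((F \o shift x) (h *: v) - F x)).
    by apply/funext => h /=; rewrite [h *: 1]mulr1 addr0 scale0r add0r.
  by split; rewrite /derivable /derive /= E.
have [df dfE] := differentiable_Ck oU UFx C1f.
have dl' : differentiable (fun s : R => F (s *: v + x)) 0.
  by apply/derivable1_diffP; exact: ex_derive.
have df' : differentiable f (F (0 *: v + x)) by rewrite scale0r add0r.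
have dc := differentiable_comp dl' df'.
have dfF : derivable (f \o F) x v by apply/derivable1P/(derivable1_diffP _ _).2.
split => //.
have -> : 'D_v (f \o F) x = 'D_1 (f \o (fun s : R => F (s *: v + x))) (0 : R).
  rewrite /derive; set q := (q in lim (q @ _)); set q' := (q in _ = lim (q @ _)).
  have -> // : q = q'.
  by apply/funext => h; rewrite /q /q' /= [h *: 1]mulr1 addr0 scale0r add0r.
rewrite (deriveE _ dc) (diff_comp dl' df') /= -(deriveE _ dl') derive_val.
rewrite scale0r add0r dfE; apply: eq_bigr => j _; congr (_ * _).
by rewrite derive_mx// mxE.
Qed.

End differentiable_Ck.

(** * Closure properties of Ck functions and bump functions *)

Section Ck_closure.
Context {R : realType} {n : nat}.
Implicit Types (U : set 'rV[R]_n) (f g : 'rV[R]_n -> R).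

(* [Ck k U f] does not require [U] to be open, so it is a pointwise condition. *)
Lemma Ck_pointwise k U f : (forall x, U x -> Ck k [set x] f) -> Ck k U f.
Proof.
elim: k f => [|k IHk] f Cf; split => //.
- by move=> x /Cf[cf _]; exact: cf.
- by move=> x /Cf[cf _]; exact: cf.
- move=> i; split; first by move=> x /Cf[_ df]; exact: (df i).1.
  by apply: IHk => x /Cf[_ df]; exact: (df i).2.
Qed.

(** Meant for functions given by different formulas near different points, such as extensions by
    zero. *)
Lemma Ck_local k U f : (forall x, U x -> exists V g,
  [/\ open V, V x, (forall y, V y -> f y = g y) & Ck k V g]) -> Ck k U f.
Proof.
move=> Cf; apply: Ck_pointwise => x /Cf[V [g [oV Vx fg Cg]]].
apply: (@Ck_sub _ _ k _ V); first by move=> _ ->.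
by apply: Ck_ext Cg => // y Vy; rewrite fg.
Qed.

Lemma Ck_le k l U f : (k <= l)%N -> Ck l U f -> Ck k U f.
Proof. by move=> /subnK <-; elim: (l - k)%N => // j IHj /CkS. Qed.

Lemma CkN k U f : open U -> Ck k U f -> Ck k U (- f).
Proof.
move=> oU Cf; apply: Ck_ext (CkM oU (Ck_cst k U (-1)) Cf) => // y _.
by rewrite fctE mulN1r.
Qed.

Lemma CkB k U f g : open U -> Ck k U f -> Ck k U g -> Ck k U (f - g).
Proof. by move=> oU Cf Cg; apply: CkD => //; exact: CkN. Qed.

Lemma Ck_sum k U (I : Type) (r : seq I) (F : I -> 'rV[R]_n -> R) : open U ->
  (forall i, Ck k U (F i)) -> Ck k U (fun x => \sum_(i <- r) F i x).
Proof.
move=> oU CF; elim: r => [|i r IHr].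
  apply: Ck_ext (Ck_cst k U 0) => // y _; by rewrite big_nil.
by apply: Ck_ext (CkD oU (CF i) IHr) => // y _; rewrite big_cons.
Qed.

Lemma CkV k U f : open U -> (forall x, U x -> f x != 0) -> Ck k U f ->
  Ck k U (fun x => (f x)^-1).
Proof.
move=> oU f0; elim: k => [|k IHk] Cf.
  by split=> // x Ux; apply: continuousV; [exact: f0|exact: Ck_cont Cf _ Ux].
have Ck' := IHk (CkS Cf).
case: Cf => [cf df]; split=> [x Ux|i].
  by apply: continuousV; [exact: f0|exact: cf].
split=> [x Ux|]; first by apply: derivableV; [exact: f0|exact: (df i).1].
apply: Ck_ext (CkN oU (CkM oU (CkM oU Ck' Ck') (df i).2)) => // y Uy.
rewrite deriveV; [|exact: f0|exact: (df i).1].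
by rewrite !fctE expr2 invfM scaleNr.
Qed.

Lemma derive_coord (x v : 'rV[R]_n) j :
  is_derive x v (fun y => y ord0 j) (v ord0 j).
Proof.
have did : derivable (id : 'rV[R]_n -> 'rV[R]_n) x v by exact: derivable_id.
split; first exact: ((@derivable_mxP R 'rV[R]_n 1 n id x v).1 did ord0 j).
have := @derive_mx R 'rV[R]_n 1 n id x v did; rewrite derive_id => /rowP/(_ j).
by rewrite mxE => <-.
Qed.

Lemma Ck_coord k U j : open U -> Ck k U (fun x => x ord0 j).
Proof.
move=> oU; case: k => [|k]; split=> //.
- by move=> x _; exact: coord_continuous.
- by move=> x _; exact: coord_continuous.
- move=> i; split; first by move=> x _; apply: ex_derive; exact: derive_coord.
  apply: Ck_ext (Ck_cst k U ((unit_vec i : 'rV[R]_n) ord0 j)) => // y _.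
  by have dc := derive_coord y (unit_vec i) j; rewrite derive_val.
Qed.

End Ck_closure.

Lemma continuous_row (R : realType) (n : nat) (T : topologicalType)
  (F : T -> 'rV[R]_n) x : (forall j, {for x, continuous (fun y => F y ord0 j)}) ->
  {for x, continuous F}.
Proof.
move=> cF A [P Px sPA].
have : \forall y \near x, forall j, P ord0 j (F y ord0 j).
  by apply: filter_forall => j; apply: (cF j); exact: Px.
by apply: filterS => y Py; apply: sPA => i j; rewrite ord1.
Qed.

(** Induction on [k] with [F] fixed and [f] varying: by the chain rule the partial derivatives of
    the composite are sums of products of a partial derivative of [F] with a partial derivative of
    [f] composed with [F]. *)
Lemma Ck_comp (R : realType) (m n k : nat) (W : set 'rV[R]_m) (U : set 'rV[R]_n)
    (F : 'rV[R]_m -> 'rV[R]_n) (f : 'rV[R]_n -> R) : open W -> open U ->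
  (forall x, W x -> U (F x)) -> (forall j, Ck k W (fun x => F x ord0 j)) ->
  Ck k U f -> Ck k W (f \o F).
Proof.
move=> oW oU FWU; elim: k f => [|k IHk] f CF Cf.
  split=> // x Wx; apply: continuous_comp; last exact: Ck_cont Cf _ (FWU _ Wx).
  by apply: continuous_row => j; exact: Ck_cont (CF j) _ Wx.
have C1f : Ck 1 U f by apply: Ck_le Cf.
have CF' j : Ck k W (fun x => F x ord0 j) by exact: CkS.
have dfF x i : W x -> is_derive x (unit_vec i) (f \o F)
    (\sum_j 'D_(unit_vec i) (fun y => F y ord0 j) x * 'D_(unit_vec j) f (F x)).
  move=> Wx; apply: (chain_rule oU C1f); first exact: FWU.
  by move=> j; apply: ((CF j).2 i).1.
split=> [x Wx|i].
  apply: continuous_comp; last exact: Ck_cont Cf _ (FWU _ Wx).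
  by apply: continuous_row => j; exact: Ck_cont (CF j) _ Wx.
split=> [x Wx|]; first by apply: ex_derive; exact: dfF.
have CS j : Ck k W ('D_(unit_vec i) (fun y => F y ord0 j) *
    ((fun y => 'D_(unit_vec j) f y) \o F)).
  by apply: (CkM oW ((CF j).2 i).2); apply: IHk => //; exact: (Cf.2 j).2.
apply: Ck_ext (Ck_sum (index_enum _) oW CS) => // y Wy.
by apply/esym; have dy := dfF y i Wy; exact: derive_val.
Qed.

(** For outer functions of a real variable, such as [ln] and [flat]: restricting [u] to the line
    through [x] reduces the claim to the one-variable chain rule. *)
Lemma is_derive_comp1 (R : realType) (V : normedModType R) (u : V -> R)
    (g : R -> R) (x v : V) (du dg : R) : is_derive x v u du ->
  is_derive (u x) 1 g dg -> is_derive x v (g \o u) (du * dg).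
Proof.
move=> hu hg.
have E (W : normedModType R) (w : V -> W) :
    (fun h : R => h^-1 *: (((fun s : R => w (s *: v + x)) \o shift (0 : R))
      (h *: 1) - w (0 *: v + x))) =
    (fun h => h^-1 *: ((w \o shift x) (h *: v) - w x)).
  by apply/funext => h /=; rewrite [h *: 1]mulr1 addr0 scale0r add0r.
have lu : is_derive (0 : R) 1 (fun s : R => u (s *: v + x)) du.
  by case: hu => hu <-; split; rewrite /derivable /derive /= (E R^o).
have hg' : is_derive (u (0 *: v + x)) 1 g dg by rewrite scale0r add0r.
have [H1 H2] := is_derive1_comp hg' lu.
have E' := E R^o (g \o u).
split; first by rewrite /derivable -E'.
by rewrite /derive -E' mulrC.
Qed.

Section ln_flat.
Context {R : realType} {n : nat}.
Implicit Types (U : set 'rV[R]_n) (f : 'rV[R]_n -> R).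

(** A case split replaces induction: the derivative f'/f is already covered by products and
    inverses. *)
Lemma Ck_ln k U f : open U -> (forall x, U x -> 0 < f x) -> Ck k U f ->
  Ck k U (fun x => ln (f x)).
Proof.
move=> oU f0 Cf.
have cl x : U x -> {for x, continuous (fun x => ln (f x))}.
  move=> Ux; apply: (continuous_comp (Ck_cont Cf Ux)).
  by apply: continuous_ln; exact: f0.
case: k Cf => [|k] Cf; split => // i.
have dl x : U x -> is_derive x (unit_vec i) (fun x => ln (f x))
    ('D_(unit_vec i) f x * (f x)^-1).
  move=> Ux; apply: is_derive_comp1; last by apply: is_derive1_ln; exact: f0.
  by apply: derivableP; exact: (Cf.2 i).1.
split=> [x Ux|]; first by apply: ex_derive; exact: dl.
have Ci : Ck k U (fun x => (f x)^-1).
  by apply: CkV (CkS Cf) => // x Ux; rewrite gt_eqF// f0.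
apply: Ck_ext (CkM oU (Cf.2 i).2 Ci) => // y Uy.
by have dy := dl y Uy; rewrite derive_val.
Qed.

(* This family is closed under derivation up to linear combinations, which is
   why the power of [t^-1] is carried along. *)
Definition flat m (t : R) : R :=
  if 0 < t then expR (- t^-1) * t^-1 ^+ m else 0.

(** With s = 1/t the exponential series gives s^(m+1) / (m+1)! <= exp s, hence exp(-s) s^m <= (m+1)!
    / s. *)
Lemma flat_le m t : `|flat m t| <= (m.+1)`!%:R * `|t|.
Proof.
rewrite /flat; case: ltP => t0; last by rewrite normr0 mulr_ge0.
rewrite !ger0_norm ?mulr_ge0 ?expR_ge0 ?exprn_ge0 ?invr_ge0 ?(ltW t0)//.
have s0 : 0 < t^-1 by rewrite invr_gt0.
have := expR_ge1Dxn m (ltW s0); rewrite expRN.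
set s := t^-1 => h.
have h' : s ^+ m.+1 <= (m.+1)`!%:R * expR s.
  rewrite mulrC -ler_pdivrMr ?ltr0n ?fact_gt0//; apply: le_trans h.
  by rewrite lerDr.
rewrite -(invrK t) -/s mulrC ler_pdivrMr ?expR_gt0//.
by rewrite mulrAC ler_pdivlMr// -exprSr.
Qed.

Lemma flat_cvg0 m : flat m @ (0 : R) --> (0 : R).
Proof.
apply/cvgrPdist_le => e e0.
have f0 : (0 : R) < (m.+1)`!%:R by rewrite ltr0n fact_gt0.
near=> t; rewrite sub0r normrN; apply: le_trans (flat_le m t) _.
rewrite -ler_pdivlMl// mulrC; near: t.
by apply/(@nbhs_norm0P R R^o); exists (e / (m.+1)`!%:R) => [|t /= /ltW//];
  rewrite /= divr_gt0.
Unshelve. all: by end_near. Qed.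

(** The delicate point is 0, where the difference quotient of [flat m] is exactly [flat m.+1], which
    tends to 0. *)
Lemma is_derive_flat m (t : R) :
  is_derive t 1 (flat m) (flat m.+2 t - m%:R * flat m.+1 t).
Proof.
have [t0|t0|->] := ltgtP t 0.
- have f0 k (y : R) : y < 0 -> flat k y = 0 by move=> y0; rewrite /flat ltNge ltW.
  rewrite !f0// mulr0 subr0.
  apply: (@near_eq_is_derive _ R^o R^o (cst 0)).
  have : \forall y \near t, y < 0 by exact: (@lt_nbhsl R).
  by apply: filterS => y y0; rewrite f0.
- apply: (@near_eq_is_derive _ R^o R^o (fun t => expR (- t^-1) * t^-1 ^+ m)).
    have : \forall y \near t, 0 < y by exact: (@lt_nbhsr R).
    by apply: filterS => y y0; rewrite /flat y0.
  have dI : is_derive t 1 (fun y : R => y^-1) (- t^-1 ^+ 2).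
    have did : derivable (id : R -> R) t 1 by exact: derivable_id.
    split; first by apply: (derivableV _ did); rewrite gt_eqF.
    rewrite (deriveV _ did) ?gt_eqF//.
    by rewrite derive_id [_ *: 1]mulr1 exprVn.
  have dE : is_derive t 1 (fun y : R => expR (- y^-1))
      (t^-1 ^+ 2 * expR (- t^-1)).
    apply: is_derive_comp1.
    by rewrite -[_ ^+ 2]opprK; exact: is_deriveN.
  have := is_deriveX m dI; rewrite exprfctE => dX.
  apply: is_derive_eq (is_deriveM dE dX) _.
  rewrite /flat t0 /GRing.scale /=.
  move: (expR _) => e; move: (t^-1) => s {dX dI dE}.

  (* For [m = 0] the truncated exponent [m.-1] is wrong, but the factor [m%:R] vanishes. *)
  have -> : m%:R * (e * s ^+ m.+1) = e * (m%:R * s ^+ m.-1 * s ^+ 2).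
    case: m => [|m]; first by rewrite !mul0r mulr0.
    by rewrite mulrCA -mulrA -exprD addn2.
  by rewrite !mulrN addrC (mulrA (s ^+ m)) -exprD addn2 (mulrC _ e).
- rewrite /flat ltxx mulr0 subr0.
  have q : (fun h : R => h^-1 *: ((flat m \o shift 0) (h *: 1) - flat m 0)) @ 0^'
      --> (0 : R).
    have /cvg_within_filter := flat_cvg0 m.+1.
    move=> /(_ (fun x => x != 0)) h.
    apply: cvg_trans h; apply: near_eq_cvg; near=> h.
    rewrite /= [h *: 1]mulr1 addr0 /flat ltxx subr0 /GRing.scale /=.
    by case: ifP => _; rewrite ?mulr0// exprS mulrCA.
  by split; [apply/cvg_ex; exists 0|exact: cvg_lim q].
Unshelve. all: by end_near. Qed.

Lemma Ck_flat k m U f : open U -> Ck k U f -> Ck k U (fun x => flat m (f x)).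
Proof.
move=> oU; elim: k m => [|k IHk] m Cf.
all: have cl x : U x -> {for x, continuous (fun x => flat m (f x))}
  by move=> Ux; apply: (continuous_comp (Ck_cont Cf Ux));
     apply: differentiable_continuous; apply/derivable1_diffP;
     apply: ex_derive; exact: is_derive_flat.
all: split => // i.
have dl x : U x -> is_derive x (unit_vec i) (fun x => flat m (f x))
    ('D_(unit_vec i) f x * (flat m.+2 (f x) - m%:R * flat m.+1 (f x))).
  move=> Ux; apply: is_derive_comp1; last exact: is_derive_flat.
  by apply: derivableP; exact: (Cf.2 i).1.
split=> [x Ux|]; first by apply: ex_derive; exact: dl.
have Cf' := CkS Cf.
apply: Ck_ext (CkM oU (Cf.2 i).2 (CkB oU (IHk m.+2 Cf')
  (CkM oU (Ck_cst k U m%:R) (IHk m.+1 Cf')))) => // y Uy.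
by have dy := dl y Uy; rewrite derive_val.
Qed.

(** The Euclidean distance makes the argument of [flat] a polynomial in the coordinates. It
    dominates the maximum norm, so the support still lies in the norm ball of radius [r]. *)
Definition bump (x0 : 'rV[R]_n) (r : R) (x : 'rV[R]_n) : R :=
  flat 0 (r ^+ 2 - \sum_j (x ord0 j - x0 ord0 j) ^+ 2).

Lemma Ck_bump k U x0 r : open U -> Ck k U (bump x0 r).
Proof.
move=> oU; apply: Ck_flat => //; apply: CkB => //; first exact: Ck_cst.
apply: Ck_sum => // j.
have C : Ck k U ((fun x : 'rV[R]_n => x ord0 j) - cst (x0 ord0 j)).
  by apply: CkB => //; [exact: Ck_coord|exact: Ck_cst].
by apply: Ck_ext (CkM oU C C) => // y _; rewrite expr2.
Qed.

Lemma bump_center_gt0 x0 r : 0 < r -> 0 < bump x0 r x0.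
Proof.
move=> r0; rewrite /bump big1 => [|j _]; last by rewrite subrr expr0n.
by rewrite subr0 /flat exprn_gt0// expr0 mulr1 expR_gt0.
Qed.

Lemma bump_supp x0 r x : 0 < r -> bump x0 r x != 0 -> `|x0 - x| <= r.
Proof.
move=> r0; rewrite /bump /flat; case: ltP => [|_]; last by rewrite eqxx.
rewrite subr_gt0 => xr _; apply: norm_le_coord (ltW r0) _ => j; rewrite !mxE.
rewrite -(@ler_pXn2r _ 2)// ?nnegrE ?(ltW r0)// real_normK ?num_real//.
rewrite -sqrrN opprB; apply: le_trans (ltW xr).
by rewrite (bigD1 j)//= lerDl sumr_ge0// => i _; exact: sqr_ge0.
Qed.

End ln_flat.

(** * Symmetry of second derivatives *)

Section schwarz.
Context {R : realType} {n : nat}.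
Implicit Types (U : set 'rV[R]_n) (f : 'rV[R]_n -> R) (x a : 'rV[R]_n).

Lemma norm_unit_vec i : `|unit_vec i : 'rV[R]_n| <= 1.
Proof.
apply: norm_le_coord => // j; rewrite mxE /=.
by case: (j == i); rewrite ?normr1 ?normr0.
Qed.

Lemma is_derive_shift_arg f a x v (d : R) :
  is_derive (a + x) v f d -> is_derive x v (fun y => f (a + y)) d.
Proof.
have E : (fun h : R => h^-1 *: (((fun y => f (a + y)) \o shift x) (h *: v)
    - f (a + x))) =
    (fun h => h^-1 *: ((f \o shift (a + x)) (h *: v) - f (a + x))).
  by apply/funext => h /=; rewrite addrCA.
by case=> df <-; split; rewrite /derivable /derive /= E.
Qed.

(** Two mean value theorems: one along [unit_vec i] for the increment [G] of [f] in direction [j],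
    then one along [unit_vec j] for the partial derivative in direction [i]. *)
Lemma second_difference U f x i j (t : R) : open U -> Ck 2 U f ->
  (forall y, `|y - x| <= `|t| + `|t| -> U y) ->
  exists2 y, `|y - x| <= `|t| + `|t| &
    f (t *: unit_vec j + (t *: unit_vec i + x)) - f (t *: unit_vec i + x)
      - (f (t *: unit_vec j + x) - f x) =
    'D_(unit_vec j) (fun y => 'D_(unit_vec i) f y) y * t * t.
Proof.
move=> oU [_ df] xU.
have te s k : `|s| <= `|t| -> `|s *: (unit_vec k : 'rV[R]_n)| <= `|t|.
  move=> st; rewrite normrZ; apply: le_trans st.
  by rewrite ler_piMr// norm_unit_vec.
pose G y := f (t *: unit_vec j + y) - f y.
have dG s : `|s| <= `|t| -> is_derive (s *: unit_vec i + x) (unit_vec i) G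
    ('D_(unit_vec i) f (t *: unit_vec j + (s *: unit_vec i + x)) -
     'D_(unit_vec i) f (s *: unit_vec i + x)).
  move=> st; apply: is_deriveB.
    apply: is_derive_shift_arg; apply: derivableP; apply: (df i).1; apply: xU.
    by rewrite addrA addrK (le_trans (ler_normD _ _))// lerD// te.
  apply: derivableP; apply: (df i).1; apply: xU.
  by rewrite addrK (le_trans (te _ _ st))// lerDl.
have [|s st] := @mvt_line _ _ G x (unit_vec i) t.
  by move=> s st; apply: ex_derive; exact: dG.
have := dG s st => dGs; rewrite derive_val => E.
have [|r rt E'] := @mvt_line _ _ (fun y => 'D_(unit_vec i) f y)
    (s *: unit_vec i + x) (unit_vec j) t.
  move=> r rt; apply: ((df i).2.2 j).1; apply: xU.
  by rewrite addrA addrK (le_trans (ler_normD _ _))// lerD// te.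
exists (r *: unit_vec j + (s *: unit_vec i + x)).
  by rewrite addrA addrK (le_trans (ler_normD _ _))// lerD// te.
by rewrite -E'; exact: E.
Qed.

(** The second difference is symmetric in [i] and [j], so the two mixed derivatives agree at points
    [y] and [z] near [x], possibly different; continuity carries the equality to [x]. *)
Lemma Ck_schwarz U f x i j : open U -> U x -> Ck 2 U f ->
  'D_(unit_vec j) (fun y => 'D_(unit_vec i) f y) x =
  'D_(unit_vec i) (fun y => 'D_(unit_vec j) f y) x.
Proof.
move=> oU Ux Cf; apply/eqP; rewrite -subr_eq0 -normr_le0.
apply/ler_addgt0Pr => e e0; rewrite add0r.
have e2 : 0 < e / 2 by rewrite divr_gt0.
have c k l : \forall y \near x,
    `|'D_(unit_vec k) (fun y => 'D_(unit_vec l) f y) x -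
      'D_(unit_vec k) (fun y => 'D_(unit_vec l) f y) y| <= e / 2.
  by have /cvgrPdist_le := ((Cf.2 l).2.2 k).2.1 x Ux; exact.
have : \forall y \near x, [/\ U y,
    `|'D_(unit_vec j) (fun y => 'D_(unit_vec i) f y) x -
      'D_(unit_vec j) (fun y => 'D_(unit_vec i) f y) y| <= e / 2 &
    `|'D_(unit_vec i) (fun y => 'D_(unit_vec j) f y) x -
      'D_(unit_vec i) (fun y => 'D_(unit_vec j) f y) y| <= e / 2].
  by apply: filterS3 (open_nbhs_nbhs (conj oU Ux)) (c j i) (c i j).
case/nbhs_normP => d /= d0 dP.
(* The points [y] and [z] are within 2t = d/2 of [x], strictly inside the ball of radius [d]. *)
have t0 : 0 < d / 4 by rewrite divr_gt0.
set t := d / 4 in t0.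
have td y : `|y - x| <= `|t| + `|t| -> `|x - y| < d.
  rewrite distrC (ger0_norm (ltW t0)) => /le_lt_trans; apply.
  by rewrite /t; lra.
have xU y : `|y - x| <= `|t| + `|t| -> U y by move=> /td /dP[].
have [y yx E] := second_difference i j oU Cf xU.
have [z zx E'] := second_difference j i oU Cf xU.
have DE : 'D_(unit_vec j) (fun y => 'D_(unit_vec i) f y) y =
    'D_(unit_vec i) (fun y => 'D_(unit_vec j) f y) z.
  apply: (mulIf (lt0r_neq0 t0)); apply: (mulIf (lt0r_neq0 t0)).
  have swap (p q r s : R) : p - q - (r - s) = p - r - (q - s) by ring.
  apply: etrans (esym E) (etrans _ E').
  by apply: etrans (swap _ _ _ _) _; rewrite addrCA.
have [_ Y _] := dP _ (td _ yx); have [_ _ Z] := dP _ (td _ zx).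
rewrite distrC -DE in Z.
have := lerD Y Z; rewrite -splitr; apply: le_trans.
exact: ler_distD.
Qed.

End schwarz.

(** * Tangent vectors, extension of fields and tensoriality *)

Section manifold_smooth.
Context {R : realType} {n : nat} {M : manifold R n}.
Implicit Types (f g : M -> R) (a b : chart R n M) (p : M).

Lemma smoothN f : smooth f -> smooth (- f).
Proof.
move=> sf a Aa k; apply: (@CkN R n k _ (f \o cinv a)); last exact: sf.
exact: ccod_open.
Qed.

Lemma smoothB f g : smooth f -> smooth g -> smooth (f - g).
Proof. by move=> sf sg; apply: smoothD => //; exact: smoothN. Qed.

Lemma smooth_ln f : (forall p, 0 < f p) -> smooth f -> smooth (@ln R \o f).
Proof.
move=> f0 sf a Aa k.
exact: (@Ck_ln R n k _ (f \o cinv a) (@ccod_open _ _ _ a) (fun x _ => f0 _) (sf a Aa k)).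
Qed.

Lemma open_chart_preimage a (A : set M) : open A ->
  open (ccod a `&` cinv a @^-1` A).
Proof.
move=> oA; rewrite openE => x [ax Ax].
apply: filterI; first exact: (open_nbhs_nbhs (conj (@ccod_open _ _ _ a) ax)).
by apply: (cinv_cont ax); exact: open_nbhs_nbhs.
Qed.

Lemma derivable_smooth f a x i : smooth f -> atlas a -> ccod a x ->
  derivable (f \o cinv a) x (unit_vec i).
Proof. by move=> sf Aa ax; apply: ((sf a Aa 1%N).2 i).1. Qed.

(** * Tangent vectors as derivations *)

Section tangent_derivation.
Variables (p : M) (v : tangent p).

Lemma tangentD f g : smooth f -> smooth g -> v (f + g) = v f + v g.
Proof.
move=> sf sg; have [a Aa ap] := atlas_cover p.
have [w vE] := (tangentP v).1 a Aa ap; have aap := cfun_cod ap.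
rewrite !vE//; last exact: smoothD.
rewrite -big_split; apply: eq_bigr => i _ /=; rewrite -mulrDr; congr (_ * _).
by rewrite -deriveD//; exact: derivable_smooth.
Qed.

Lemma tangentM f g : smooth f -> smooth g -> v (f * g) = f p * v g + g p * v f.
Proof.
move=> sf sg; have [a Aa ap] := atlas_cover p.
have [w vE] := (tangentP v).1 a Aa ap; have aap := cfun_cod ap.
rewrite !vE//; last exact: smoothM.
rewrite !mulr_sumr -big_split; apply: eq_bigr => i _ /=.
rewrite [in RHS]mulrCA [X in _ + X]mulrCA -mulrDr; congr (_ * _).
have := deriveM (derivable_smooth (i := i) sf Aa aap) (derivable_smooth (i := i) sg Aa aap).
by rewrite /= cfunK.
Qed.

Lemma tangent_cst c : v (fun=> c) = 0.
Proof.
have [a Aa ap] := atlas_cover p; have [w vE] := (tangentP v).1 a Aa ap.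
rewrite vE; last exact: smooth_cst.
apply: big1 => i _; rewrite (_ : _ \o _ = cst c)//.
by rewrite derive_cst mulr0.
Qed.

Lemma tangentZ c f : smooth f -> v (fun q => c * f q) = c * v f.
Proof.
move=> sf; rewrite -[LHS]/(v (cst c * f)).
by rewrite (tangentM (smooth_cst c) sf) tangent_cst mulr0 addr0.
Qed.

Lemma tangent_ln f : (forall q, 0 < f q) -> smooth f ->
  v (@ln R \o f) = v f / f p.
Proof.
move=> f0 sf; have [a Aa ap] := atlas_cover p.
have [w vE] := (tangentP v).1 a Aa ap; have aap := cfun_cod ap.
rewrite !vE//; last exact: smooth_ln.
rewrite mulr_suml; apply: eq_bigr => i _; rewrite -mulrA; congr (_ * _).
have d := is_derive_comp1 (derivableP (derivable_smooth (i := i) sf Aa aap))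
  (is_derive1_ln (f0 (cinv a (a p)))).
by case: d => _; rewrite /= cfunK.
Qed.

End tangent_derivation.

(** * Extension by zero from a chart, cut-off coordinates and fields *)

Definition chart_ext a (h : 'rV[R]_n -> R) (q : M) : R :=
  if `[<cdom a q>] then h (a q) else 0.

Lemma chart_ext_in a h q : cdom a q -> chart_ext a h q = h (a q).
Proof. by move=> aq; rewrite /chart_ext asboolT. Qed.

Lemma chart_ext_out a h q : ~ cdom a q -> chart_ext a h q = 0.
Proof. by move=> aq; rewrite /chart_ext asboolF. Qed.

Lemma chart_extK a h x : ccod a x -> (chart_ext a h \o cinv a) x = h x.
Proof. by move=> ax; rewrite /= chart_ext_in ?cinvK//; exact: cinv_dom. Qed.

(** Inside the domain of [a] the extension is [h] after a transition map. A point outside has a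
    neighbourhood where it is zero: the image of [K] in the manifold is compact, hence closed since
    the manifold is Hausdorff, and the point is not in it. *)
Lemma smooth_chart_ext a (h : 'rV[R]_n -> R) (K : set 'rV[R]_n) : atlas a ->
  compact K -> K `<=` ccod a -> smooth_on (ccod a) h ->
  (forall x, h x != 0 -> K x) -> smooth (chart_ext a h).
Proof.
move=> Aa cK Ka sh hK b Ab k; apply: Ck_local => x bx.
have [ap|nap] := pselect (cdom a (cinv b x)).
  pose V := ccod b `&` cinv b @^-1` cdom a.
  have oV : open V by apply: open_chart_preimage; exact: cdom_open.
  exists V, (h \o (fun y => a (cinv b y))); split => //.
    by move=> y [by_ ay]; rewrite /= chart_ext_in.
  apply: (Ck_comp oV (@ccod_open _ _ _ a)) => [y [_ /cfun_cod]//|j|]; last exact: sh.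
  exact: (atlas_compat Ab Aa).
have cl : closed (cinv a @` K).
  apply: compact_closed (@mspace_hausdorff _ _ M) _.
  apply: continuous_compact cK; apply: continuous_in_subspaceT => y.
  by rewrite inE => /Ka; exact: cinv_cont.
exists (ccod b `&` cinv b @^-1` (~` (cinv a @` K))), (fun=> 0); split.
- by apply: open_chart_preimage; rewrite openC.
- by split=> // -[y Ky yx]; apply: nap; rewrite -yx; apply: cinv_dom; exact: Ka.
- move=> y [_ ny] /=; have [ay|] := pselect (cdom a (cinv b y)); last first.
    exact: chart_ext_out.
  rewrite chart_ext_in//; apply/eqP/negPn/negP => /hK Kay; apply: ny.
  by exists (a (cinv b y)) => //; rewrite cfunK.
- exact: Ck_cst.
Qed.

Lemma chart_bump a p : atlas a -> cdom a p -> exists chi : 'rV[R]_n -> R,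
  [/\ smooth_on setT chi, 0 < chi (a p) &
    forall h, smooth_on (ccod a) h -> smooth (chart_ext a (chi * h))].
Proof.
move=> Aa ap; have aap := cfun_cod ap.
have /nbhs_normP[d /= d0 dP] := open_nbhs_nbhs (conj (@ccod_open _ _ _ a) aap).
(* Halving the radius puts the closed ball [K] inside the open ball contained in the chart. *)
have r0 : 0 < d / 2 by rewrite divr_gt0.
pose K := closed_ball_ Num.norm (a p) (d / 2).
exists (bump (a p) (d / 2)); split.
- by move=> k; apply: Ck_bump; exact: openT.
- exact: bump_center_gt0.
move=> h sh; apply: (@smooth_chart_ext _ _ K) => //.
- apply: bounded_closed_compact; last exact: closed_closed_ball_.
  exists (`|a p| + d / 2); split; first exact: num_real.
  move=> N /ltW hN y; rewrite /K /closed_ball_ /= => Ky; apply: le_trans hN.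
  by rewrite -[y in leLHS](subrK (a p)) addrC (le_trans (ler_normD _ _))//
    lerD2l distrC.
- move=> y; rewrite /K /closed_ball_ /= => Ky; apply: dP.
  by apply: le_lt_trans Ky _; rewrite /= ltr_pdivrMr// ltr_pMr// ltr1n.
- by move=> k; apply: (CkM (@ccod_open _ _ _ a)); [apply: Ck_bump; exact: ccod_open|exact: sh].
- move=> y; rewrite fctE mulf_eq0 negb_or => /andP[+ _].
  exact: bump_supp.
Qed.

Section coordinates.
Variables (a : chart R n M) (Aa : atlas a).

Lemma derive_chart_ext p h v : cdom a p ->
  'D_v (chart_ext a h \o cinv a) (a p) = 'D_v h (a p).
Proof.
move=> ap; apply: near_eq_derive; apply: (near_open (@ccod_open _ _ _ a)).
  by move=> y; exact: chart_extK.
exact: cfun_cod.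
Qed.

(** [is_tangent] asks for coefficients in every chart [b] at [p]: they are the image of [w] under
    the Jacobian of the transition map, by the chain rule. *)
Lemma is_tangent_coord p (ap : cdom a p) (w : 'rV[R]_n) :
  is_tangent p (fun f => if `[<smooth f>] then
    \sum_i w ord0 i * 'D_(unit_vec i) (f \o cinv a) (a p) else 0).
Proof.
split=> [b Ab bp|f nf]; last by rewrite asboolF.
pose T (x : 'rV[R]_n) := b (cinv a x).
exists (\row_j \sum_i w ord0 i * 'D_(unit_vec i) (fun x => T x ord0 j) (a p)).
move=> f sf; rewrite asboolT//.
pose V := ccod a `&` cinv a @^-1` cdom b.
have oV : open V by apply: open_chart_preimage; exact: cdom_open.
have Vap : V (a p) by split; [exact: cfun_cod|rewrite /= cfunK].
have dT i : 'D_(unit_vec i) (f \o cinv a) (a p) =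
    \sum_j 'D_(unit_vec i) (fun x => T x ord0 j) (a p) *
      'D_(unit_vec j) (f \o cinv b) (b p).
  have -> : 'D_(unit_vec i) (f \o cinv a) (a p) =
      'D_(unit_vec i) ((f \o cinv b) \o T) (a p).
    apply: near_eq_derive; apply: (near_open oV) => // y [_ by_].
    by rewrite /T /= cfunK.
  have C1 : Ck 1 (ccod b) (f \o cinv b) by exact: sf.
  have Tp : T (a p) = b p by rewrite /T cfunK.
  have := @chain_rule R n _ _ _ T (a p) (unit_vec i) (@ccod_open _ _ _ b) C1.
  rewrite Tp => /(_ (cfun_cod bp))[|_ <-//].
  by move=> j; apply: ((atlas_compat Aa Ab j 1%N).2 i).1.
under eq_bigr do rewrite dT mulr_sumr.
rewrite exchange_big; apply: eq_bigr => j _ /=; rewrite mxE mulr_suml.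
by apply: eq_bigr => i _; rewrite mulrA.
Qed.

Definition tangent_coord p (ap : cdom a p) w := Tangent (is_tangent_coord ap w).

Lemma tangent_coordE p (ap : cdom a p) w f : smooth f ->
  tangent_coord ap w f = \sum_i w ord0 i * 'D_(unit_vec i) (f \o cinv a) (a p).
Proof. by move=> sf; rewrite /= asboolT. Qed.

Section bump_field.
Variables (chi : 'rV[R]_n -> R) (schi : smooth_on setT chi).
Hypothesis ext_smooth : forall h, smooth_on (ccod a) h ->
  smooth (chart_ext a (chi * h)).

(** The factor [cst 1] gives the bump function the shape to which [ext_smooth] applies. *)
Let chi' := chart_ext a (chi * cst 1).
Let xi j := chart_ext a (chi * (fun x => x ord0 j)).

Lemma smooth_bump : smooth chi'.
Proof. by apply: ext_smooth => k; exact: Ck_cst. Qed.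

Lemma smooth_bump_coord j : smooth (xi j).
Proof. by apply: ext_smooth => k; apply: Ck_coord; exact: ccod_open. Qed.

(* The left-hand side is a globally defined substitute for the j-th coordinate. *)
Lemma bump_coord p (ap : cdom a p) (v : tangent p) (w : 'rV[R]_n) j :
  (forall f, smooth f ->
    v f = \sum_i w ord0 i * 'D_(unit_vec i) (f \o cinv a) (a p)) ->
  chi' p * v (xi j) - xi j p * v chi' = chi (a p) ^+ 2 * w ord0 j.
Proof.
move=> vE; rewrite (vE _ smooth_bump) (vE _ (smooth_bump_coord j)).
rewrite /chi' /xi !chart_ext_in// !mulr_sumr -sumrB.
have dchi i : derivable chi (a p) (unit_vec i) by apply: ((schi 1%N).2 i).1.
have D i : 'D_(unit_vec i) (chi * (fun x => x ord0 j)) (a p) =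
    chi (a p) * (i == j)%:R + a p ord0 j * 'D_(unit_vec i) chi (a p).
  have dx := derive_coord (a p) (unit_vec i) j.
  have dx' : derivable (fun x : 'rV[R]_n => x ord0 j) (a p) (unit_vec i).
    exact: ex_derive.
  by rewrite (deriveM (dchi i) dx') derive_val mxE eqxx /= eq_sym.
have D1 i : 'D_(unit_vec i) (chi * cst 1) (a p) = 'D_(unit_vec i) chi (a p).
  by congr ('D_ _ _ _); apply/funext => x; rewrite fctE mulr1.
rewrite (bigD1 j)//= [X in _ + X]big1 ?addr0 => [|i ij].
  by rewrite !derive_chart_ext// D D1 eqxx !fctE /= mulr1n; ring.
by rewrite !derive_chart_ext// D D1 (negbTE ij) !fctE /= mulr0n; ring.
Qed.

Definition bump_field_fun (w : 'rV[R]_n) (p : M) : tangent p :=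
  match pselect (cdom a p) with
  | left ap => tangent_coord ap (chi (a p) *: w)
  | right _ => 0
  end.

Lemma bump_fieldE w p (ap : cdom a p) f : smooth f -> bump_field_fun w p f =
  chi (a p) * \sum_i w ord0 i * 'D_(unit_vec i) (f \o cinv a) (a p).
Proof.
move=> sf; rewrite /bump_field_fun; case: pselect => // ap'.
rewrite tangent_coordE// mulr_sumr; apply: eq_bigr => i _.
by rewrite mxE mulrA.
Qed.

Lemma bump_field_subproof w f : smooth f ->
  smooth (fun p => bump_field_fun w p f).
Proof.
move=> sf.
pose h x := \sum_i w ord0 i * 'D_(unit_vec i) (f \o cinv a) x.
have -> : (fun p => bump_field_fun w p f) = chart_ext a (chi * h).
  apply/funext => p; have [ap|nap] := pselect (cdom a p).
    by rewrite bump_fieldE// chart_ext_in.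
  by rewrite chart_ext_out// /bump_field_fun; case: pselect.
apply: ext_smooth => k; apply: Ck_sum => [|i]; first exact: ccod_open.
apply: (CkM (@ccod_open _ _ _ a) (Ck_cst k _ (w ord0 i))).
exact: ((sf a Aa k.+1).2 i).2.
Qed.

Definition bump_field w := VField (bump_field_subproof w).

Lemma smooth_field_coord (X : vfield M) j :
  smooth (chi' * (fun p => X p (xi j)) - xi j * (fun p => X p chi')).
Proof.
apply: smoothB; apply: smoothM; try exact: smooth_bump;
  try exact: smooth_bump_coord.
- by apply: vfieldP; exact: smooth_bump_coord.
- by apply: vfieldP; exact: smooth_bump.
Qed.

Lemma big_vfieldE (I : Type) (r : seq I) (F : I -> vfield M) p f :
  (\big[vfield_add/vfield0]_(i <- r) F i) p f = \sum_(i <- r) F i p f.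
Proof. exact: (big_morph (fun X : vfield M => X p f)). Qed.

(** Origin of the cube: by [bump_coord] a coefficient of [X] becomes a global smooth function only
    after multiplication by chi^2, and the coordinate field becomes global after multiplication by a
    third chi. *)
Lemma bump_cube_field (X : vfield M) :
  vfield_scale (smoothM smooth_bump (smoothM smooth_bump smooth_bump)) X =
  \big[vfield_add/vfield0]_j
    vfield_scale (smooth_field_coord X j) (bump_field (unit_vec j)).
Proof.
apply: vfield_ext => p; apply: tangent_ext => f sf.
rewrite big_vfieldE /= !fctE.
have [ap|nap] := pselect (cdom a p); last first.
  rewrite /chi' chart_ext_out// mul0r mul0r big1// => j _.
  by rewrite /bump_field_fun; case: pselect => // _; rewrite mulr0.
have [w vE] := (tangentP (X p)).1 a Aa ap.
under eq_bigr do rewrite !fctE (bump_coord ap _ vE) (bump_fieldE _ ap sf).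
rewrite vE// /chi' chart_ext_in// mulr_sumr; apply: eq_bigr => j _.
rewrite (bigD1 j)//= big1 => [|i ij]; last by rewrite mxE (negbTE ij) mul0r.
by rewrite mxE !eqxx /= !fctE; ring.
Qed.

End bump_field.

End coordinates.

Lemma vfield_extend p (u : tangent p) : exists X : vfield M, X p = u.
Proof.
have [a Aa ap] := atlas_cover p; have [w uE] := (tangentP u).1 a Aa ap.
have [chi [schi chi0 ext]] := chart_bump Aa ap.
exists (bump_field Aa ext ((chi (a p))^-1 *: w)).
apply: tangent_ext => f sf; rewrite /= (bump_fieldE Aa _ _ ap sf) uE// mulr_sumr.
by apply: eq_bigr => i _; rewrite mxE !mulrA mulfV ?gt_eqF// mul1r.
Qed.

(** * Functionals linear over smooth functions depend on values at a point *)

Section tensorial.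
Variables (p : M) (F : vfield M -> R).
Hypothesis FD : forall X Y, F (vfield_add X Y) = F X + F Y.
Hypothesis FZ : forall h (sh : smooth h) X, F (vfield_scale sh X) = h p * F X.

(** Apply [F] to [bump_cube_field]: the coefficients on the right vanish at [p] with [X], and on the
    left the factor chi(p)^3 is nonzero. *)
Lemma tensorial_eq0 (X : vfield M) : X p = 0 -> F X = 0.
Proof.
move=> X0; have [a Aa ap] := atlas_cover p.
have [chi [schi chi0 ext]] := chart_bump Aa ap.
have F0 : F vfield0 = 0.
  by rewrite -(_ : vfield_scale (smooth_cst 0) vfield0 = vfield0) ?FZ ?mul0r//;
     apply: vfield_ext => q; exact: scale0r.
have := congr1 F (bump_cube_field Aa schi ext X).
rewrite (big_morph F FD F0) FZ big1 => [/eqP|j _]; last first.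
  by rewrite FZ !fctE /= X0 !mulr0 subrr mul0r.
rewrite -[(_ * _) p]/(chart_ext a _ p * (chart_ext a _ p * chart_ext a _ p)).
rewrite !chart_ext_in// -[(_ * _) (a p)]/(chi (a p) * 1) mulr1.
by rewrite !mulf_eq0 (gt_eqF chi0) => /eqP.
Qed.

Lemma tensorial_eq (X Y : vfield M) : X p = Y p -> F X = F Y.
Proof.
move=> XY; pose Z := vfield_add X (vfield_scale (smooth_cst (-1)) Y).
have /tensorial_eq0 : Z p = 0 by rewrite /= XY scaleN1r subrr.
by rewrite FD FZ mulN1r => /eqP; rewrite subr_eq0 => /eqP.
Qed.

End tensorial.

End manifold_smooth.

(** * Lifts to a product *)

(** [is_tangent] provides coefficients point by point, with no regularity. [bump_coord] expresses
    chi^2 times a coefficient by the action of [X] on global functions, so it is smooth, and chi^2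
    can be divided out where chi is nonzero. *)
Lemma vfield_local_coord (R : realType) (n : nat) (M : manifold R n)
    (X : vfield M) (a : chart R n M) p : atlas a -> cdom a p ->
  exists (V : set 'rV[R]_n) (W : 'I_n -> 'rV[R]_n -> R),
  [/\ open V, V (a p), V `<=` ccod a, (forall i, smooth_on V (W i)) &
    forall x f, V x -> smooth f ->
      X (cinv a x) f = \sum_i W i x * 'D_(unit_vec i) (f \o cinv a) x].
Proof.
move=> Aa ap; have [chi [schi chi0 ext]] := chart_bump Aa ap.
pose V := ccod a `&` [set x | chi x != 0].
have oV : open V.
  apply: openI; first exact: ccod_open.
  apply: (@open_comp _ _ chi [set y | y != 0]); last exact: open_neq.
  by move=> x _; exact: Ck_cont (schi 0%N) _ I.
have Va : V `<=` ccod a by move=> x [].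
have [A [sA AE]] : exists A : 'I_n -> M -> R, (forall j, smooth (A j)) /\
    forall q (w : 'rV[R]_n), cdom a q -> (forall f, smooth f ->
      X q f = \sum_i w ord0 i * 'D_(unit_vec i) (f \o cinv a) (a q)) ->
    forall j, A j q = chi (a q) ^+ 2 * w ord0 j.
  exists (fun j => chart_ext a (chi * cst 1) *
      (fun q => X q (chart_ext a (chi * (fun x => x ord0 j)))) -
    chart_ext a (chi * (fun x => x ord0 j)) *
      (fun q => X q (chart_ext a (chi * cst 1)))).
  split; first exact: smooth_field_coord ext X.
  by move=> q w aq vE j; rewrite -(bump_coord schi ext aq j vE).
exists V, (fun i x => (A i \o cinv a) x * ((chi x)^-1 * (chi x)^-1)); split => //.
- by split; [exact: cfun_cod|rewrite /= gt_eqF].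
- move=> i k; have CV : Ck k V (fun x => (chi x)^-1).
    by apply: CkV => // [x []//|]; exact: Ck_sub (@subsetT _ _) (schi k).
  by apply: (CkM oV _ (CkM oV CV CV)); apply: (Ck_sub Va); exact: sA.
move=> x f [ax chix] sf; have ap' := cinv_dom ax.
have [w vE] := (tangentP (X (cinv a x))).1 a Aa ap'.
rewrite vE// cinvK//; apply: eq_bigr => i _; congr (_ * _).
rewrite /= (AE _ _ ap' vE) cinvK// expr2.
by field.
Qed.

Section product_calculus.
Context {R : realType} {n1 n2 : nat}.

Lemma derive_row_mxl (G : 'rV[R]_(n1 + n2) -> R) (x v : 'rV[R]_n1) y :
  'D_v (fun x => G (row_mx x y)) x = 'D_(row_mx v 0) G (row_mx x y).
Proof.
rewrite /derive; set q := (q in lim (q @ _)); set q' := (q in _ = lim (q @ _)).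
have -> // : q = q'.
by apply/funext => h; rewrite /q /q' /= scale_row_mx scaler0 add_row_mx add0r.
Qed.

Lemma derive_row_mxr (G : 'rV[R]_(n1 + n2) -> R) x (y v : 'rV[R]_n2) :
  'D_v (fun y => G (row_mx x y)) y = 'D_(row_mx 0 v) G (row_mx x y).
Proof.
rewrite /derive; set q := (q in lim (q @ _)); set q' := (q in _ = lim (q @ _)).
have -> // : q = q'.
by apply/funext => h; rewrite /q /q' /= scale_row_mx scaler0 add_row_mx add0r.
Qed.

Lemma derivable_row_mxl (G : 'rV[R]_(n1 + n2) -> R) (x v : 'rV[R]_n1) y :
  derivable G (row_mx x y) (row_mx v 0) -> derivable (fun x => G (row_mx x y)) x v.
Proof.
rewrite /derivable; set q := (q in cvg (q @ _)).
set q' := (q in _ -> cvg (q @ _)).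
have -> // : q' = q.
by apply/funext => h; rewrite /q /q' /= scale_row_mx scaler0 add_row_mx add0r.
Qed.

Lemma derivable_row_mxr (G : 'rV[R]_(n1 + n2) -> R) x (y v : 'rV[R]_n2) :
  derivable G (row_mx x y) (row_mx 0 v) -> derivable (fun y => G (row_mx x y)) y v.
Proof.
rewrite /derivable; set q := (q in cvg (q @ _)).
set q' := (q in _ -> cvg (q @ _)).
have -> // : q' = q.
by apply/funext => h; rewrite /q /q' /= scale_row_mx scaler0 add_row_mx add0r.
Qed.

Lemma unit_vec_lshift i :
  unit_vec (lshift n2 i) = row_mx (unit_vec i) 0 :> 'rV[R]_(n1 + n2).
Proof.
apply/rowP => j; rewrite !mxE; case: split_ordP => k ->; rewrite !mxE.
  by rewrite (inj_eq (@lshift_inj _ _)).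
by rewrite eq_rlshift andbF.
Qed.

Lemma unit_vec_rshift i :
  unit_vec (rshift n1 i) = row_mx 0 (unit_vec i) :> 'rV[R]_(n1 + n2).
Proof.
apply/rowP => j; rewrite !mxE; case: split_ordP => k ->; rewrite !mxE.
  by rewrite eq_lrshift andbF.
by rewrite (inj_eq (@rshift_inj _ _)).
Qed.

Context {M1 : manifold R n1} {M2 : manifold R n2}.
Local Notation M := (prod_manifold M1 M2).
Implicit Types (f : M -> R) (z : M) (a : chart R n1 M1) (b : chart R n2 M2).

Lemma atlas_prod a b : atlas a -> atlas b ->
  atlas (prod_chart a b : chart R (n1 + n2) M).
Proof. by move=> Aa Ab; exists a => //; exists b. Qed.

Lemma smooth_slicel f (q : M2) : smooth f -> smooth (fun p : M1 => f (p, q)).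
Proof.
move=> sf a Aa k; have [b Ab bq] := atlas_cover q.
have bbq := cfun_cod bq.
have Cf := sf _ (atlas_prod Aa Ab) k.
pose F (x : 'rV[R]_n1) : 'rV[R]_(n1 + n2) := row_mx x (b q).
have -> : (fun p => f (p, q)) \o cinv a = (f \o cinv (prod_chart a b)) \o F.
  by apply/funext => x; rewrite /F /= row_mxKl row_mxKr cfunK.
apply: (Ck_comp (@ccod_open _ _ _ a) (@ccod_open _ _ _ (prod_chart a b)) _ _ Cf).
  by move=> x ax; rewrite /F /=; split; rewrite /= ?row_mxKl ?row_mxKr.
move=> j; rewrite /F; case: (split_ordP j) => i ->.
  have -> : (fun x : 'rV[R]_n1 => row_mx x (b q) ord0 (lshift n2 i)) =
      (fun x => x ord0 i) by apply/funext => x; rewrite row_mxEl.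
  by apply: Ck_coord; exact: ccod_open.
have -> : (fun x : 'rV[R]_n1 => row_mx x (b q) ord0 (rshift n1 i)) =
    (fun=> b q ord0 i) by apply/funext => x; rewrite row_mxEr.
exact: Ck_cst.
Qed.

Lemma smooth_slicer f (p : M1) : smooth f -> smooth (fun q : M2 => f (p, q)).
Proof.
move=> sf b Ab k; have [a Aa ap] := atlas_cover p.
have aap := cfun_cod ap.
have Cf := sf _ (atlas_prod Aa Ab) k.
pose F (y : 'rV[R]_n2) : 'rV[R]_(n1 + n2) := row_mx (a p) y.
have -> : (fun q => f (p, q)) \o cinv b = (f \o cinv (prod_chart a b)) \o F.
  by apply/funext => y; rewrite /F /= row_mxKl row_mxKr cfunK.
apply: (Ck_comp (@ccod_open _ _ _ b) (@ccod_open _ _ _ (prod_chart a b)) _ _ Cf).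
  by move=> y by_; rewrite /F /=; split; rewrite /= ?row_mxKl ?row_mxKr.
move=> j; rewrite /F; case: (split_ordP j) => i ->.
  have -> : (fun y : 'rV[R]_n2 => row_mx (a p) y ord0 (lshift n2 i)) =
      (fun=> a p ord0 i) by apply/funext => y; rewrite row_mxEl.
  exact: Ck_cst.
have -> : (fun y : 'rV[R]_n2 => row_mx (a p) y ord0 (rshift n1 i)) =
    (fun y => y ord0 i) by apply/funext => y; rewrite row_mxEr.
by apply: Ck_coord; exact: ccod_open.
Qed.

Lemma derive_slicel f a b (q : M2) x i : cdom b q ->
  'D_(unit_vec i) ((fun p => f (p, q)) \o cinv a) x =
  'D_(unit_vec (lshift n2 i)) (f \o cinv (prod_chart a b)) (row_mx x (b q)).
Proof.
move=> bq; rewrite unit_vec_lshift -derive_row_mxl; congr ('D_ _ _ _).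
by apply/funext => y; rewrite /= row_mxKl row_mxKr cfunK.
Qed.

Lemma derive_slicer f a b (p : M1) y i : cdom a p ->
  'D_(unit_vec i) ((fun q => f (p, q)) \o cinv b) y =
  'D_(unit_vec (rshift n1 i)) (f \o cinv (prod_chart a b)) (row_mx (a p) y).
Proof.
move=> ap; rewrite unit_vec_rshift -derive_row_mxr; congr ('D_ _ _ _).
by apply/funext => x; rewrite /= row_mxKl row_mxKr cfunK.
Qed.

(** In a product chart the sum over the coordinates breaks into two blocks, each of which
    differentiates one slice of [f]. Computations on the product thereby reduce to the factors. *)
Lemma tangent_split z (u : tangent z) f : smooth f ->
  u f = dfst u (fun p => f (p, z.2)) + dsnd u (fun q => f (z.1, q)).
Proof.
move=> sf; have [a Aa ap] := atlas_cover z.1; have [b Ab bq] := atlas_cover z.2.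
have [w uE] := (tangentP u).1 _ (atlas_prod Aa Ab) (conj ap bq).
have uE' g : smooth g -> u g =
    \sum_i w ord0 (lshift n2 i) *
      'D_(unit_vec i) ((fun p => g (p, z.2)) \o cinv a) (a z.1) +
    \sum_i w ord0 (rshift n1 i) *
      'D_(unit_vec i) ((fun q => g (z.1, q)) \o cinv b) (b z.2).
  move=> sg; rewrite uE// big_split_ord /=; congr (_ + _); apply: eq_bigr => i _.
    by rewrite (derive_slicel _ _ _ _ bq).
  by rewrite (derive_slicer _ _ _ _ ap).
have dc m (c : R) (x v : 'rV[R]_m) : 'D_v (fun=> c) x = 0 by exact: derive_cst.
rewrite uE' //= !asboolT; [|exact: smooth_slicer|exact: smooth_slicel].
rewrite uE'; last by apply: smooth_hfun; exact: smooth_slicel.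
rewrite uE'; last by apply: smooth_vfun; exact: smooth_slicer.
rewrite /hfun /vfun /comp /=; congr (_ + _).
  by rewrite [X in _ + X]big1 ?addr0// => i _; rewrite dc mulr0.
by rewrite [X in X + _]big1 ?add0r// => i _; rewrite dc mulr0.
Qed.

Lemma tangent_prod_eq z (u v : tangent z) :
  dfst u = dfst v -> dsnd u = dsnd v -> u = v.
Proof.
by move=> uv1 uv2; apply: tangent_ext => f sf; rewrite !tangent_split// uv1 uv2.
Qed.

Lemma dfstE z (u : tangent z) (f : M1 -> R) : smooth f -> dfst u f = u (hfun f).
Proof. by move=> sf; rewrite /= asboolT. Qed.

Lemma dsndE z (u : tangent z) (f : M2 -> R) : smooth f -> dsnd u f = u (vfun f).
Proof. by move=> sf; rewrite /= asboolT. Qed.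

Lemma dfstD z (u v : tangent z) : dfst (u + v) = dfst u + dfst v.
Proof.
apply: tangent_ext => f sf; rewrite dfstE//.
by rewrite -[RHS]/(dfst u f + dfst v f) !dfstE.
Qed.

Lemma dfstZ z c (u : tangent z) : dfst (c *: u) = c *: dfst u.
Proof.
apply: tangent_ext => f sf; rewrite dfstE//.
by rewrite -[RHS]/(c * dfst u f) dfstE.
Qed.

Lemma dsndD z (u v : tangent z) : dsnd (u + v) = dsnd u + dsnd v.
Proof.
apply: tangent_ext => f sf; rewrite dsndE//.
by rewrite -[RHS]/(dsnd u f + dsnd v f) !dsndE.
Qed.

Lemma dsndZ z c (u : tangent z) : dsnd (c *: u) = c *: dsnd u.
Proof.
apply: tangent_ext => f sf; rewrite dsndE//.
by rewrite -[RHS]/(c * dsnd u f) dsndE.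
Qed.

Lemma is_tangent_prod z (u1 : tangent (z.1 : M1)) (u2 : tangent (z.2 : M2)) :
  is_tangent z (fun f => if `[<smooth f>] then
    u1 (fun p => f (p, z.2)) + u2 (fun q => f (z.1, q)) else 0).
Proof.
split=> [c Ac cz|f nf]; last by rewrite asboolF.
have [a Aa [b Ab cE]] := Ac; rewrite -{}cE {c Ac} in cz *.
case: cz => /= ap bq.
have [w1 u1E] := (tangentP u1).1 a Aa ap.
have [w2 u2E] := (tangentP u2).1 b Ab bq.
exists (row_mx w1 w2) => f sf; rewrite asboolT// big_split_ord /=.
rewrite u1E; last exact: smooth_slicel.
rewrite u2E; last exact: smooth_slicer.
congr (_ + _); apply: eq_bigr => i _.
  by rewrite row_mxEl (derive_slicel _ _ _ _ bq).
by rewrite row_mxEr (derive_slicer _ _ _ _ ap).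
Qed.

Definition tangent_prod z u1 u2 : tangent z := Tangent (@is_tangent_prod z u1 u2).

Lemma tangent_prodE z u1 u2 f : smooth f -> @tangent_prod z u1 u2 f =
  u1 (fun p => f (p, z.2)) + u2 (fun q => f (z.1, q)).
Proof. by move=> sf; rewrite /= asboolT. Qed.

Lemma dfst_tangent_prod z u1 u2 : dfst (@tangent_prod z u1 u2) = u1.
Proof.
apply: tangent_ext => f sf; rewrite dfstE// tangent_prodE; last exact: smooth_hfun.
by rewrite /hfun /= (tangent_cst u2) addr0.
Qed.

Lemma dsnd_tangent_prod z u1 u2 : dsnd (@tangent_prod z u1 u2) = u2.
Proof.
apply: tangent_ext => f sf; rewrite dsndE// tangent_prodE; last exact: smooth_vfun.
by rewrite /vfun /= (tangent_cst u1) add0r.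
Qed.

(** The function to which [X1] is applied varies with [z], so [vfieldP] does not suffice. With
    smooth local coefficients of [X1] the expression is a sum of products of smooth functions in a
    product chart. *)
Lemma smooth_dirder_slicel (X1 : vfield M1) f : smooth f ->
  smooth (fun z : M => X1 z.1 (fun p => f (p, z.2))).
Proof.
move=> sf c Ac k; have [a Aa [b Ab cE]] := Ac; rewrite -{}cE {c Ac}.
apply: Ck_local => x cx.
have [V [W [oV Vx Va sW WE]]] := vfield_local_coord X1 Aa (cinv_dom cx.1).
pose V' := ccod (prod_chart a b) `&` lsubmx @^-1` V.
have oV' : open V'.
  apply: openI; first exact: ccod_open.
  by apply: open_comp => // y _; exact: lsubmx_continuous.
exists V', (fun y => \sum_i (W i \o lsubmx) y *
  'D_(unit_vec (lshift n2 i)) (f \o cinv (prod_chart a b)) y); split => //.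
- by split=> //; move: Vx; rewrite cinvK//; exact: cx.1.
- move=> y [cy Vy] /=; rewrite WE//; last exact: smooth_slicel.
  apply: eq_bigr => i _; congr (_ * _).
  rewrite (@derive_slicel _ a b _ _ _ (cinv_dom cy.2)) cinvK ?hsubmxK//.
  exact: cy.2.
apply: (Ck_sum _ oV') => i; apply: (CkM oV').
  by apply: Ck_sub (smooth_lsubmx (sW i) k) => y [].
apply: (@Ck_sub _ _ k _ (ccod (prod_chart a b))) => [y []//|].
exact: ((sf _ (atlas_prod Aa Ab) k.+1).2 _).2.
Qed.

Lemma smooth_dirder_slicer (X2 : vfield M2) f : smooth f ->
  smooth (fun z : M => X2 z.2 (fun q => f (z.1, q))).
Proof.
move=> sf c Ac k; have [a Aa [b Ab cE]] := Ac; rewrite -{}cE {c Ac}.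
apply: Ck_local => x cx.
have [V [W [oV Vx Vb sW WE]]] := vfield_local_coord X2 Ab (cinv_dom cx.2).
pose V' := ccod (prod_chart a b) `&` rsubmx @^-1` V.
have oV' : open V'.
  apply: openI; first exact: ccod_open.
  by apply: open_comp => // y _; exact: rsubmx_continuous.
exists V', (fun y => \sum_i (W i \o rsubmx) y *
  'D_(unit_vec (rshift n1 i)) (f \o cinv (prod_chart a b)) y); split => //.
- by split=> //; move: Vx; rewrite cinvK//; exact: cx.2.
- move=> y [cy Vy] /=; rewrite WE//; last exact: smooth_slicer.
  apply: eq_bigr => i _; congr (_ * _).
  rewrite (@derive_slicer _ a b _ _ _ (cinv_dom cy.1)) cinvK ?hsubmxK//.
  exact: cy.1.
apply: (Ck_sum _ oV') => i; apply: (CkM oV').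
  by apply: Ck_sub (smooth_rsubmx (sW i) k) => y [].
apply: (@Ck_sub _ _ k _ (ccod (prod_chart a b))) => [y []//|].
exact: ((sf _ (atlas_prod Aa Ab) k.+1).2 _).2.
Qed.

Lemma prod_field_subproof (X1 : vfield M1) (X2 : vfield M2) f : smooth f ->
  smooth (fun z : M => tangent_prod (X1 z.1) (X2 z.2) f).
Proof.
move=> sf; have -> : (fun z : M => tangent_prod (X1 z.1) (X2 z.2) f) =
    (fun z => X1 z.1 (fun p => f (p, z.2))) +
    (fun z => X2 z.2 (fun q => f (z.1, q))).
  by apply/funext => z; rewrite tangent_prodE.
by apply: smoothD; [exact: smooth_dirder_slicel|exact: smooth_dirder_slicer].
Qed.

Definition prod_field X1 X2 : vfield M := VField (prod_field_subproof X1 X2).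

(** [prod_field] inhabits the set from which [xget] chooses, which excludes the default value. *)
Lemma hlift_spec (X1 : vfield M1) z :
  dfst (hlift X1 z : tangent z) = X1 z.1 /\ dsnd (hlift X1 z : tangent z) = 0.
Proof.
rewrite /hlift; case: xgetP => [X _ /(_ z)//|/(_ (prod_field X1 vfield0))[]].
by move=> z' /=; rewrite dfst_tangent_prod dsnd_tangent_prod.
Qed.

Lemma vlift_spec (X2 : vfield M2) z :
  dfst (vlift X2 z : tangent z) = 0 /\ dsnd (vlift X2 z : tangent z) = X2 z.2.
Proof.
rewrite /vlift; case: xgetP => [X _ /(_ z)//|/(_ (prod_field vfield0 X2))[]].
by move=> z' /=; rewrite dfst_tangent_prod dsnd_tangent_prod.
Qed.

Lemma hliftE (X1 : vfield M1) z f : smooth f ->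
  hlift X1 z f = X1 z.1 (fun p => f (p, z.2)).
Proof.
move=> sf; rewrite tangent_split//.
by rewrite (hlift_spec X1 z).1 (hlift_spec X1 z).2 addr0.
Qed.

Lemma vliftE (X2 : vfield M2) z f : smooth f ->
  vlift X2 z f = X2 z.2 (fun q => f (z.1, q)).
Proof.
move=> sf; rewrite tangent_split//.
by rewrite (vlift_spec X2 z).1 (vlift_spec X2 z).2 add0r.
Qed.

Lemma tangent_lift z (u : tangent z) :
  exists (X1 : vfield M1) (X2 : vfield M2),
    u = vfield_add (hlift X1) (vlift X2) z.
Proof.
have [X1 E1] := vfield_extend (dfst u); have [X2 E2] := vfield_extend (dsnd u).
exists X1, X2; have [h1 h2] := hlift_spec X1 z; have [v1 v2] := vlift_spec X2 z.
apply: tangent_prod_eq; first by rewrite dfstD h1 v1 addr0 E1.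
by rewrite dsndD h2 v2 add0r E2.
Qed.

(* Symmetry of second partial derivatives: torsion-freeness is tested on all
   functions of the product, not only on lifted ones. *)
Lemma lift_commute (X1 : vfield M1) (Y2 : vfield M2) f z : smooth f ->
  hlift X1 z (dirder (vlift Y2) f) = vlift Y2 z (dirder (hlift X1) f).
Proof.
move=> sf.
rewrite (hliftE _ _ (vfieldP (vlift Y2) sf)) (vliftE _ _ (vfieldP (hlift X1) sf)).
have -> : (fun p => dirder (vlift Y2) f (p, z.2)) =
    (fun p => Y2 z.2 (fun q => f (p, q))).
  by apply/funext => p; rewrite /dirder vliftE.
have -> : (fun q => dirder (hlift X1) f (z.1, q)) =
    (fun q => X1 z.1 (fun p => f (p, q))).
  by apply/funext => q; rewrite /dirder hliftE.
have [a Aa ap] := atlas_cover z.1; have [b Ab bq] := atlas_cover z.2.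
have [w1 X1E] := (tangentP (X1 z.1)).1 a Aa ap.
have [w2 Y2E] := (tangentP (Y2 z.2)).1 b Ab bq.
have sX : smooth (fun q => X1 z.1 (fun p => f (p, q))).
  exact: smooth_slicer (z.1) (smooth_dirder_slicel X1 sf).
have sY : smooth (fun p => Y2 z.2 (fun q => f (p, q))).
  exact: smooth_slicel (z.2) (smooth_dirder_slicer Y2 sf).
rewrite X1E// Y2E//.
pose F := f \o cinv (prod_chart a b).
have oc : open (ccod (prod_chart a b)) by exact: ccod_open.
have cz : ccod (prod_chart a b) (row_mx (a z.1) (b z.2)).
  by split; rewrite /= ?row_mxKl ?row_mxKr; exact: cfun_cod.
have CF : Ck 2 (ccod (prod_chart a b)) F by exact: sf (atlas_prod Aa Ab) 2%N.
(* The coefficients [w2] belong to the fixed point [z.2], so moving along the first factor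
   differentiates only the partial derivatives of [F]. *)
have DY i : 'D_(unit_vec i) ((fun p => Y2 z.2 (fun q => f (p, q))) \o cinv a)
    (a z.1) = \sum_j w2 ord0 j * 'D_(unit_vec (lshift n2 i))
      (fun y => 'D_(unit_vec (rshift n1 j)) F y) (row_mx (a z.1) (b z.2)).
  pose G j (x : 'rV[R]_n1) := w2 ord0 j *
    'D_(unit_vec (rshift n1 j)) F (row_mx x (b z.2)).
  have -> : 'D_(unit_vec i) ((fun p => Y2 z.2 (fun q => f (p, q))) \o cinv a)
      (a z.1) = 'D_(unit_vec i) (\sum_j G j) (a z.1).
    apply: near_eq_derive; apply: (near_open (@ccod_open _ _ _ a)); last exact: cfun_cod.
    move=> x ax /=; rewrite Y2E; last exact: smooth_slicer.
    rewrite fct_sumE; apply: eq_bigr => j _; rewrite /G.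
    by rewrite (@derive_slicer f a b _ _ _ (cinv_dom ax)) cinvK.
  have dG j : is_derive (a z.1) (unit_vec i) (G j) (w2 ord0 j *
      'D_(unit_vec (lshift n2 i)) (fun y => 'D_(unit_vec (rshift n1 j)) F y)
        (row_mx (a z.1) (b z.2))).
    have d : derivable (fun y => 'D_(unit_vec (rshift n1 j)) F y)
        (row_mx (a z.1) (b z.2)) (unit_vec (lshift n2 i)).
      exact: ((CF.2 _).2.2 _).1.
    rewrite unit_vec_lshift in d *; rewrite -derive_row_mxl.
    by apply: is_deriveZ; apply: derivableP; exact: derivable_row_mxl d.
  have dS := is_derive_sum dG; exact: derive_val.
have DX j : 'D_(unit_vec j) ((fun q => X1 z.1 (fun p => f (p, q))) \o cinv b)
    (b z.2) = \sum_i w1 ord0 i * 'D_(unit_vec (rshift n1 j))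
      (fun y => 'D_(unit_vec (lshift n2 i)) F y) (row_mx (a z.1) (b z.2)).
  pose G i (y : 'rV[R]_n2) := w1 ord0 i *
    'D_(unit_vec (lshift n2 i)) F (row_mx (a z.1) y).
  have -> : 'D_(unit_vec j) ((fun q => X1 z.1 (fun p => f (p, q))) \o cinv b)
      (b z.2) = 'D_(unit_vec j) (\sum_i G i) (b z.2).
    apply: near_eq_derive; apply: (near_open (@ccod_open _ _ _ b)); last exact: cfun_cod.
    move=> y by_ /=; rewrite X1E; last exact: smooth_slicel.
    rewrite fct_sumE; apply: eq_bigr => i _; rewrite /G.
    by rewrite (@derive_slicel f a b _ _ _ (cinv_dom by_)) cinvK.
  have dG i : is_derive (b z.2) (unit_vec j) (G i) (w1 ord0 i *
      'D_(unit_vec (rshift n1 j)) (fun y => 'D_(unit_vec (lshift n2 i)) F y)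
        (row_mx (a z.1) (b z.2))).
    have d : derivable (fun y => 'D_(unit_vec (lshift n2 i)) F y)
        (row_mx (a z.1) (b z.2)) (unit_vec (rshift n1 j)).
      exact: ((CF.2 _).2.2 _).1.
    rewrite unit_vec_rshift in d *; rewrite -derive_row_mxr.
    by apply: is_deriveZ; apply: derivableP; exact: derivable_row_mxr d.
  have dS := is_derive_sum dG; exact: derive_val.
under eq_bigr do rewrite DY mulr_sumr.
under [RHS]eq_bigr do rewrite DX mulr_sumr.
rewrite exchange_big; apply: eq_bigr => j _; apply: eq_bigr => i _ /=.
by rewrite (Ck_schwarz _ _ oc cz CF) mulrCA.
Qed.

End product_calculus.

(** * Torsion and derivative of the metric as tensors *)

Section tensors.
Context {R : realType} {n : nat} {M : manifold R n}.
Variables (D : connection M) (g : riemannian M).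
Implicit Types (X Y Z : vfield M) (p : M).

Lemma metricDl p (u v w : tangent p) : g p (u + v) w = g p u w + g p v w.
Proof. by rewrite -{1}(scale1r u) metric_linear mul1r. Qed.

Lemma metric0l p (w : tangent p) : g p 0 w = 0.
Proof.
by apply: (addrI (g p 0 w)); rewrite -metricDl !addr0.
Qed.

Lemma metricZl p c (u w : tangent p) : g p (c *: u) w = c * g p u w.
Proof. by rewrite -[c *: u]addr0 metric_linear metric0l addr0. Qed.

(** Scalar valued, because the bracket is an operator on functions and not a field. *)
Definition torsion X Y f p : R :=
  D X Y p f - D Y X p f - (X p (dirder Y f) - Y p (dirder X f)).

Lemma torsion_freeP : torsion_free D <->
  forall X Y f p, smooth f -> torsion X Y f p = 0.
Proof.
split=> [T X Y f p sf|T X Y f sf].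
  by apply/eqP; rewrite subr_eq0; apply/eqP; exact: (congr1 (fun h => h p) (T X Y f sf)).
by apply/funext => p; apply/eqP; rewrite -subr_eq0; apply/eqP; exact: T.
Qed.

Lemma torsionC X Y f p : torsion X Y f p = - torsion Y X f p.
Proof.
rewrite /torsion; move: (D X Y p f) (D Y X p f) (X p _) (Y p _) => a b x y.
ring.
Qed.

Lemma torsionDl X X' Y f p : smooth f ->
  torsion (vfield_add X X') Y f p = torsion X Y f p + torsion X' Y f p.
Proof.
move=> sf; rewrite /torsion nablaDl nablaDr.
rewrite [Y p (dirder (vfield_add X X') f)](tangentD _ (vfieldP X sf) (vfieldP X' sf)).
rewrite /dirder /=.
move: (D X Y p f) (D X' Y p f) (D Y X p f) (D Y X' p f) => a b c d.
move: (X p _) (X' p _) (Y p _) (Y p _) => x x' y y'.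
ring.
Qed.

Lemma torsionDr X Y Y' f p : smooth f ->
  torsion X (vfield_add Y Y') f p = torsion X Y f p + torsion X Y' f p.
Proof. by move=> sf; rewrite torsionC torsionDl// opprD -!torsionC. Qed.

(** The term Y(h) X(f) arises twice, from the Leibniz rule of the connection and from the bracket,
    with opposite signs. *)
Lemma torsionZl h (sh : smooth h) X Y f p : smooth f ->
  torsion (vfield_scale sh X) Y f p = h p * torsion X Y f p.
Proof.
move=> sf; rewrite /torsion nablaZl nabla_leibniz.
rewrite [Y p (dirder (vfield_scale sh X) f)](tangentM _ sh (vfieldP X sf)).
rewrite /dirder /=.
move: (D X Y p f) (D Y X p f) => a b.
move: (X p f) (X p _) (Y p _) (Y p h) (h p) => x x' y y' r.
ring.
Qed.

Lemma torsion_eq X X' Y Y' f p : smooth f -> X p = X' p -> Y p = Y' p ->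
  torsion X Y f p = torsion X' Y' f p.
Proof.
move=> sf XX' YY'.
have E (A B C : vfield M) : B p = C p -> torsion B A f p = torsion C A f p.
  apply: (tensorial_eq (F := fun B => torsion B A f p)) => *.
    exact: torsionDl.
  exact: torsionZl.
by rewrite (E _ _ _ XX') torsionC (E _ _ _ YY') -torsionC.
Qed.

Lemma nabla_metricE X Y Z p : nabla_metric D g X Y Z p =
  X p (metric_fun g Y Z) - g p (D X Y p) (Z p) - g p (Y p) (D X Z p).
Proof. by []. Qed.

Lemma nabla_metricC X Y Z p : nabla_metric D g X Y Z p = nabla_metric D g X Z Y p.
Proof.
rewrite !nabla_metricE [g p (Y p) _]Defs.metric_sym [g p (Z p) _]Defs.metric_sym addrAC.
congr (X p _ - _ - _).
by apply/funext => q; exact: Defs.metric_sym.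
Qed.

Lemma nabla_metricD1 X X' Y Z p : nabla_metric D g (vfield_add X X') Y Z p =
  nabla_metric D g X Y Z p + nabla_metric D g X' Y Z p.
Proof.
rewrite !nabla_metricE !nablaDl metricDl ![g p (Y p) _]Defs.metric_sym metricDl /=.
move: (X p _) (X' p _) (g p _ _) (g p _ _) (g p _ _) (g p _ _) => a b c d e r.
ring.
Qed.

Lemma nabla_metricZ1 h (sh : smooth h) X Y Z p :
  nabla_metric D g (vfield_scale sh X) Y Z p = h p * nabla_metric D g X Y Z p.
Proof.
rewrite !nabla_metricE !nablaZl metricZl ![g p (Y p) _]Defs.metric_sym metricZl /=.
move: (X p _) (g p _ _) (g p _ _) (h p) => a b c r.
ring.
Qed.

Lemma nabla_metricD2 X Y Y' Z p : nabla_metric D g X (vfield_add Y Y') Z p =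
  nabla_metric D g X Y Z p + nabla_metric D g X Y' Z p.
Proof.
rewrite !nabla_metricE !nablaDr.
have -> : metric_fun g (vfield_add Y Y') Z = metric_fun g Y Z + metric_fun g Y' Z.
  by apply/funext => q; exact: metricDl.
rewrite tangentD; try exact: metric_smooth.
rewrite !metricDl /=.
move: (X p _) (X p _) (g p _ _) (g p _ _) (g p _ _) (g p _ _) => a b c d e r.
ring.
Qed.

(** X(h) g(Y, Z) from differentiating the metric cancels against the Leibniz term of the
    connection. *)
Lemma nabla_metricZ2 h (sh : smooth h) X Y Z p :
  nabla_metric D g X (vfield_scale sh Y) Z p = h p * nabla_metric D g X Y Z p.
Proof.
rewrite !nabla_metricE !nabla_leibniz.
have -> : metric_fun g (vfield_scale sh Y) Z = h * metric_fun g Y Z.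
  by apply/funext => q; exact: metricZl.
rewrite tangentM//; last exact: metric_smooth.
rewrite !metricDl !metricZl /= /metric_fun.
move: (X p _) (X p _) (g p _ _) (g p _ _) (g p _ _) (h p) => a b c d e r.
ring.
Qed.

Lemma nabla_metricD3 X Y Z Z' p : nabla_metric D g X Y (vfield_add Z Z') p =
  nabla_metric D g X Y Z p + nabla_metric D g X Y Z' p.
Proof. by rewrite nabla_metricC nabla_metricD2 -!(nabla_metricC _ Y). Qed.

Lemma nabla_metric_eq X X' Y Y' Z Z' p : X p = X' p -> Y p = Y' p -> Z p = Z' p ->
  nabla_metric D g X Y Z p = nabla_metric D g X' Y' Z' p.
Proof.
move=> XX' YY' ZZ'.
have E1 (A B U V : vfield M) : U p = V p -> nabla_metric D g U A B p = nabla_metric D g V A B p.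
  apply: (tensorial_eq (F := fun U => nabla_metric D g U A B p)) => *.
    exact: nabla_metricD1.
  exact: nabla_metricZ1.
have E2 (A B U V : vfield M) : U p = V p -> nabla_metric D g A U B p = nabla_metric D g A V B p.
  apply: (tensorial_eq (F := fun U => nabla_metric D g A U B p)) => *.
    exact: nabla_metricD2.
  exact: nabla_metricZ2.
by rewrite (E1 _ _ _ _ XX') (E2 _ _ _ _ YY') nabla_metricC (E2 _ _ _ _ ZZ') nabla_metricC.
Qed.

End tensors.

(** * The induced connection *)

Section induced.
Context {R : realType} {n1 n2 : nat}.
Context {M1 : manifold R n1} {M2 : manifold R n2}.
Local Notation M := (prod_manifold M1 M2).
Variables (g1 : riemannian M1) (g2 : riemannian M2).
Variables (f1 : M1 -> R) (f2 : M2 -> R).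
Hypotheses (sf1 : smooth f1) (sf2 : smooth f2).
Hypotheses (f1_gt0 : forall p, 0 < f1 p).
Variables (c : R) (g : riemannian M).
Hypothesis gE : forall (z : M) (u v : tangent z),
  g z u v = warped_metric c g1 g2 f1 f2 u v.
Variables (G1 : vfield M1) (G2 : vfield M2).
Hypotheses (G1_grad : is_gradient g1 f1 G1) (G2_grad : is_gradient g2 f2 G2).
Variables (D1 : connection M1) (D2 : connection M2) (D : connection M).
Hypothesis D_induced : induced_connection c g1 g2 f1 f2 G1 G2 D1 D2 D.

(** The squared length of grad f1 is written as its action on [f1]; [kE] identifies the two. *)
Let k (z : M) := 1 + (c * f2 z.2) ^+ 2 * G1 z.1 f1.

Lemma warp_factor_gt0 z : 0 < k z.
Proof.
rewrite /k ltr_pwDl// mulr_ge0 ?sqr_ge0// -G1_grad.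
have [->|G0] := eqVneq (G1 z.1) 0; first by rewrite metric0l.
exact: ltW (metric_pos _ G0).
Qed.

Let coef_hh (X Y : vfield M1) z :=
  (c * f2 z.2) ^+ 2 * hessian D1 f1 X Y z.1 / k z.
Let coef_mixed (X : vfield M1) (Y : vfield M2) z :=
  c ^+ 2 * f2 z.2 * Y z.2 f2 * X z.1 f1 / k z.
Let coef_vv (X Y : vfield M2) z := f1 z.1 * g2 z.2 (X z.2) (Y z.2) / k z.

Let kE z : 1 + (c * f2 z.2) ^+ 2 * hfun (metric_fun g1 G1 G1) z = k z.
Proof. by rewrite /k /hfun /metric_fun G1_grad. Qed.

(** * The metric, the connection and the derivative of the metric on lifts *)

Lemma metric_hlift z (u : tangent z) (X : vfield M1) : g z u (hlift X z) =
  g1 z.1 (dfst u) (X z.1) + c ^+ 2 * f2 z.2 ^+ 2 * (dfst u f1 * X z.1 f1).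
Proof.
have [h1 h2] := hlift_spec X z.
rewrite gE /warped_metric -!dfstE// h1 h2 [g2 _ _ 0]Defs.metric_sym metric0l.
by rewrite mulr0 addr0.
Qed.

Lemma metric_vlift z (u : tangent z) (X : vfield M2) : g z u (vlift X z) =
  f1 z.1 ^+ 2 * g2 z.2 (dsnd u) (X z.2).
Proof.
have [h1 h2] := vlift_spec X z.
rewrite gE /warped_metric -!dfstE// h1 h2 [g1 _ _ 0]Defs.metric_sym metric0l.
by rewrite add0r [(0 : tangent _) f1](_ : _ = 0)// !mulr0 addr0.
Qed.

Lemma connection_hhE X Y z : D (hlift X) (hlift Y) z = hlift (D1 X Y) z +
  coef_hh X Y z *: hlift G1 z +
  (- (c ^+ 2 * f2 z.2 * (X z.1 f1 / f1 z.1 * (Y z.1 f1 / f1 z.1)))) *: vlift G2 z.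
Proof.
have [-> _ _ _] := D_induced; rewrite /vfun kE scaleNr; congr (_ + _ - _ *: _).
by rewrite /hfun -[(_ * _) z.1]/(X z.1 _ * Y z.1 _) !tangent_ln.
Qed.

Lemma connection_vvE X Y z : D (vlift X) (vlift Y) z =
  vlift (D2 X Y) z + (- coef_vv X Y z) *: hlift G1 z.
Proof.
by have [_ -> _ _] := D_induced; rewrite /vfun kE scaleNr.
Qed.

Lemma connection_hvE X Y z : D (hlift X) (vlift Y) z =
  coef_mixed X Y z *: hlift G1 z + (X z.1 f1 / f1 z.1) *: vlift Y z.
Proof.
have [_ _ -> _] := D_induced; rewrite /vfun kE.
by rewrite /hfun -[dirder X (_ \o _) z.1]/(X z.1 _) tangent_ln.
Qed.

Lemma connection_vhE X Y z : D (vlift Y) (hlift X) z =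
  coef_mixed X Y z *: hlift G1 z + (X z.1 f1 / f1 z.1) *: vlift Y z.
Proof.
have [_ _ _ ->] := D_induced; rewrite /vfun kE.
by rewrite /hfun -[dirder X (_ \o _) z.1]/(X z.1 _) tangent_ln.
Qed.

Lemma dfst_hlift (X : vfield M1) z : dfst (hlift X z : tangent (z : M)) = X z.1.
Proof. exact: (hlift_spec X z).1. Qed.

Lemma dsnd_hlift (X : vfield M1) z : dsnd (hlift X z : tangent (z : M)) = 0.
Proof. exact: (hlift_spec X z).2. Qed.

Lemma dfst_vlift (X : vfield M2) z : dfst (vlift X z : tangent (z : M)) = 0.
Proof. exact: (vlift_spec X z).1. Qed.

Lemma dsnd_vlift (X : vfield M2) z : dsnd (vlift X z : tangent (z : M)) = X z.2.
Proof. exact: (vlift_spec X z).2. Qed.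

Let liftE := (@dfstD, @dfstZ, @dsndD, @dsndZ, dfst_hlift, dsnd_hlift,
  dfst_vlift, dsnd_vlift, @scaler0, @addr0, @add0r).

Let eval_add (N : nat) (P : manifold R N) (p : P) (u v : tangent p) f a :
  (u + a *: v) f = u f + a * v f.
Proof. by []. Qed.

Let eval_scale (N : nat) (P : manifold R N) (p : P) (v : tangent p) f a :
  (a *: v) f = a * v f.
Proof. by []. Qed.

(** The summand c^2 f2^2 df1 (x) df1 of the metric contributes c^2 f2^2 (H(X,Y) Z(f1) + Y(f1)
    H(X,Z)), H being the Hessian of [f1]; the Hessian terms of the connection remove exactly
    this. *)
Lemma nabla_metric_hhh X Y Z z : nabla_metric D g (hlift X) (hlift Y) (hlift Z) z =
  nabla_metric D1 g1 X Y Z z.1.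
Proof.
rewrite !nabla_metricE [g z (hlift Y z) _]Defs.metric_sym.
rewrite [g1 z.1 (Y z.1) _]Defs.metric_sym.
rewrite hliftE; last exact: metric_smooth.
have -> : (fun p => metric_fun g (hlift Y) (hlift Z) (p, z.2)) =
    metric_fun g1 Y Z +
    (fun p => c ^+ 2 * f2 z.2 ^+ 2 * (dirder Y f1 * dirder Z f1) p).
  by apply/funext => p; rewrite /metric_fun metric_hlift dfst_hlift.
have sY := vfieldP Y sf1; have sZ := vfieldP Z sf1.
have sYZ : smooth (dirder Y f1 * dirder Z f1) by exact: smoothM.
rewrite tangentD; [|exact: metric_smooth|exact: smoothM (smooth_cst _) sYZ].
rewrite tangentZ// tangentM// !metric_hlift !connection_hhE !liftE.
rewrite !metricDl !metricZl !G1_grad !eval_add /coef_hh /hessian.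
have := lt0r_neq0 (warp_factor_gt0 z); rewrite /k.
rewrite -[(_ - _) z.1]/(X z.1 (dirder Y f1) - D1 X Y z.1 f1).
rewrite -[(_ - _) z.1]/(X z.1 (dirder Z f1) - D1 X Z z.1 f1).
rewrite -[dirder Y f1 z.1]/(Y z.1 f1) -[dirder Z f1 z.1]/(Z z.1 f1).
move: (X z.1 _) (X z.1 _) (X z.1 _) (Y z.1 f1) (Z z.1 f1) => x1 x2 x3 y0 z0.
move: (D1 X Y z.1 f1) (D1 X Z z.1 f1) (g1 _ _ _) (g1 _ _ _) => a b m1 m2.
move: (G1 z.1 f1) (f2 z.2) => b1 r k0.
by field.
Qed.

(** The two lifts are orthogonal, so only the grad f2 term of one covariant derivative and the grad
    f1 term of the other remain. They pair to c^2 f2 X(f1) Y(f1) Z(f2) with opposite signs, the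
    factor f1^2 of the metric absorbing both logarithmic derivatives. *)
Lemma nabla_metric_hhv X Y Z z :
  nabla_metric D g (hlift X) (hlift Y) (vlift Z) z = 0.
Proof.
rewrite !nabla_metricE [g z (hlift Y z) _]Defs.metric_sym.
rewrite hliftE; last exact: metric_smooth.
have -> : (fun p => metric_fun g (hlift Y) (vlift Z) (p, z.2)) = (fun=> 0).
  apply/funext => p.
  by rewrite /metric_fun metric_vlift dsnd_hlift metric0l mulr0.
rewrite tangent_cst metric_vlift metric_hlift connection_hhE connection_hvE !liftE.
rewrite !metricZl !G1_grad !G2_grad !eval_scale /coef_mixed.
have := lt0r_neq0 (warp_factor_gt0 z); rewrite /k.
have := lt0r_neq0 (f1_gt0 z.1).
move: (f1 z.1) (X z.1 f1) (Y z.1 f1) (Z z.2 f2) => f x y t.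
move: (G1 z.1 f1) (f2 z.2) => b1 r f0 k0.
by field; rewrite f0 k0.
Qed.

(** The derivative 2 f1 X(f1) of f1^2 is matched half by each of the two terms X(ln f1). *)
Lemma nabla_metric_hvv X Y Z z :
  nabla_metric D g (hlift X) (vlift Y) (vlift Z) z = 0.
Proof.
rewrite !nabla_metricE [g z (vlift Y z) _]Defs.metric_sym.
rewrite hliftE; last exact: metric_smooth.
have -> : (fun p => metric_fun g (vlift Y) (vlift Z) (p, z.2)) =
    (fun p => g2 z.2 (Y z.2) (Z z.2) * (f1 * f1) p).
  by apply/funext => p; rewrite /metric_fun metric_vlift dsnd_vlift mulrC.
rewrite tangentZ; last exact: smoothM.
rewrite tangentM// !metric_vlift !connection_hvE !liftE !metricZl.
rewrite [g2 _ (Z z.2) _]Defs.metric_sym.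
have := lt0r_neq0 (f1_gt0 z.1).
move: (f1 z.1) (X z.1 f1) (g2 _ _ _) => f x m f0.
by field.
Qed.

(** The derivative of c^2 f2^2 along [X] is matched half by each mixed covariant derivative. *)
Lemma nabla_metric_vhh X Y Z z :
  nabla_metric D g (vlift X) (hlift Y) (hlift Z) z = 0.
Proof.
rewrite !nabla_metricE [g z (hlift Y z) _]Defs.metric_sym.
rewrite vliftE; last exact: metric_smooth.
have -> : (fun q => metric_fun g (hlift Y) (hlift Z) (z.1, q)) =
    (fun=> g1 z.1 (Y z.1) (Z z.1)) +
    (fun q => c ^+ 2 * (Y z.1 f1 * Z z.1 f1) * (f2 * f2) q).
  apply/funext => q; rewrite /metric_fun metric_hlift dfst_hlift /=.
  by congr (_ + _); rewrite -[(f2 * f2) q]/(f2 q * f2 q) expr2; ring.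
have s22 : smooth (f2 * f2) by exact: smoothM.
rewrite tangentD; [|exact: smooth_cst|exact: smoothM (smooth_cst _) s22].
rewrite tangent_cst tangentZ// tangentM//.
rewrite !metric_hlift !connection_vhE !liftE !metricZl !G1_grad !eval_scale /coef_mixed.
have := lt0r_neq0 (warp_factor_gt0 z); rewrite /k.
move: (X z.2 f2) (Y z.1 f1) (Z z.1 f1) => x y t.
move: (G1 z.1 f1) (f2 z.2) => b1 r k0.
by field.
Qed.

(** Both covariant derivatives pair to f1 Y(f1) g2(X, Z), with opposite signs. *)
Lemma nabla_metric_vhv X Y Z z :
  nabla_metric D g (vlift X) (hlift Y) (vlift Z) z = 0.
Proof.
rewrite !nabla_metricE [g z (hlift Y z) _]Defs.metric_sym.
rewrite vliftE; last exact: metric_smooth.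
have -> : (fun q => metric_fun g (hlift Y) (vlift Z) (z.1, q)) = (fun=> 0).
  apply/funext => q.
  by rewrite /metric_fun metric_vlift dsnd_hlift metric0l mulr0.
rewrite tangent_cst metric_vlift metric_hlift connection_vhE connection_vvE !liftE.
rewrite !metricZl !G1_grad !eval_scale /coef_vv.
have := lt0r_neq0 (warp_factor_gt0 z); rewrite /k.
have := lt0r_neq0 (f1_gt0 z.1).
move: (f1 z.1) (Y z.1 f1) (g2 _ _ _) => f y m.
move: (G1 z.1 f1) (f2 z.2) => b1 r f0 k0.
by field; rewrite f0 k0.
Qed.

Lemma nabla_metric_vvv X Y Z z : nabla_metric D g (vlift X) (vlift Y) (vlift Z) z =
  f1 z.1 ^+ 2 * nabla_metric D2 g2 X Y Z z.2.
Proof.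
rewrite !nabla_metricE [g z (vlift Y z) _]Defs.metric_sym.
rewrite [g2 z.2 (Y z.2) _]Defs.metric_sym.
rewrite vliftE; last exact: metric_smooth.
have -> : (fun q => metric_fun g (vlift Y) (vlift Z) (z.1, q)) =
    (fun q => f1 z.1 ^+ 2 * metric_fun g2 Y Z q).
  by apply/funext => q; rewrite /metric_fun metric_vlift dsnd_vlift.
rewrite tangentZ; last exact: metric_smooth.
by rewrite !metric_vlift !connection_vvE !liftE !mulrBr.
Qed.

(** Of the eight types of components, hvh and vvh have no lemma of their own; symmetry in the last
    two arguments turns them into hhv and vhv. *)
Lemma nabla_metric_lift (X1 Y1 Z1 : vfield M1) (X2 Y2 Z2 : vfield M2) z :
  nabla_metric D g (vfield_add (hlift X1) (vlift X2))
    (vfield_add (hlift Y1) (vlift Y2)) (vfield_add (hlift Z1) (vlift Z2)) z =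
  nabla_metric D1 g1 X1 Y1 Z1 z.1 + f1 z.1 ^+ 2 * nabla_metric D2 g2 X2 Y2 Z2 z.2.
Proof.
rewrite nabla_metricD1 !nabla_metricD2 !nabla_metricD3.
rewrite nabla_metric_hhh nabla_metric_vvv !nabla_metric_hhv !nabla_metric_hvv.
rewrite !nabla_metric_vhh !nabla_metric_vhv.
rewrite [X in _ + (X + _) + _]nabla_metricC nabla_metric_hhv.
rewrite [X in _ + (_ + (X + _))]nabla_metricC nabla_metric_vhv.
by rewrite !addr0 !add0r.
Qed.

(** The grad f2 term is symmetric in [X] and [Y] and drops out, while the antisymmetrized Hessian
    H(X,Y) - H(Y,X) is minus the torsion of [D1] applied to [f1]. *)
Lemma torsion_hh (X Y : vfield M1) f z : smooth f ->
  torsion D (hlift X) (hlift Y) f z =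
  torsion D1 X Y (fun p => f (p, z.2)) z.1 -
  (c * f2 z.2) ^+ 2 / k z * torsion D1 X Y f1 z.1 * G1 z.1 (fun p => f (p, z.2)).
Proof.
move=> sf; rewrite /torsion !connection_hhE !eval_add.
rewrite !(hliftE _ _ sf) !(vliftE _ _ sf).
rewrite (hliftE _ _ (vfieldP (hlift Y) sf)) (hliftE _ _ (vfieldP (hlift X) sf)).
have E (A : vfield M1) : (fun p => dirder (hlift A) f (p, z.2)) =
    dirder A (fun p => f (p, z.2)).
  by apply/funext => p; rewrite /dirder hliftE.
rewrite !E /coef_hh /hessian.
rewrite -[(_ - _) z.1]/(X z.1 (dirder Y f1) - D1 X Y z.1 f1).
rewrite -[(_ - _) z.1]/(Y z.1 (dirder X f1) - D1 Y X z.1 f1).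
have := lt0r_neq0 (warp_factor_gt0 z).
have := lt0r_neq0 (f1_gt0 z.1).
move: (k z) (f1 z.1) => kz f1z.
move: (D1 X Y z.1 _) (D1 Y X z.1 _) (D1 X Y z.1 _) (D1 Y X z.1 _) => a1 a2 a3 a4.
move: (X z.1 (dirder _ _)) (X z.1 (dirder _ _)) => x1 x2.
move: (Y z.1 (dirder _ _)) (Y z.1 (dirder _ _)) => y1 y2.
move: (X z.1 _) (Y z.1 _) (G1 z.1 _) (G2 z.2 _) (f2 z.2) => x y s t r f0 k0.
by field; rewrite f0 k0.
Qed.

Lemma torsion_vv (X Y : vfield M2) f z : smooth f ->
  torsion D (vlift X) (vlift Y) f z =
  torsion D2 X Y (fun q => f (z.1, q)) z.2.
Proof.
move=> sf; rewrite /torsion !connection_vvE !eval_add /coef_vv.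
rewrite [g2 _ (Y z.2) _]Defs.metric_sym.
rewrite !(hliftE _ _ sf) !(vliftE _ _ sf).
rewrite (vliftE _ _ (vfieldP (vlift Y) sf)) (vliftE _ _ (vfieldP (vlift X) sf)).
have E (A : vfield M2) : (fun q => dirder (vlift A) f (z.1, q)) =
    dirder A (fun q => f (z.1, q)).
  by apply/funext => q; rewrite /dirder vliftE.
rewrite !E; congr (_ - _).
by rewrite opprD addrACA subrr addr0.
Qed.

(** Both covariant derivatives are the same expression, so only the bracket of the lifts remains. *)
Lemma torsion_hv (X : vfield M1) (Y : vfield M2) f z : smooth f ->
  torsion D (hlift X) (vlift Y) f z = 0.
Proof.
move=> sf; rewrite /torsion connection_hvE connection_vhE lift_commute//.
by rewrite !subrr.
Qed.

Lemma torsion_lift (X1 Y1 : vfield M1) (X2 Y2 : vfield M2) f z : smooth f ->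
  torsion D (vfield_add (hlift X1) (vlift X2))
    (vfield_add (hlift Y1) (vlift Y2)) f z =
  torsion D (hlift X1) (hlift Y1) f z + torsion D (vlift X2) (vlift Y2) f z.
Proof.
move=> sf; rewrite torsionDl// !torsionDr// torsion_hv// addr0.
by rewrite [X in _ + (X + _)]torsionC torsion_hv// oppr0 add0r.
Qed.

Lemma torsion_free_induced :
  torsion_free D <-> torsion_free D1 /\ torsion_free D2.
Proof.
(* Returning from the product to one factor means evaluating over some point of the other one. *)
have [p0 _] := @mspace_nonempty _ _ M1; have [q0 _] := @mspace_nonempty _ _ M2.
split=> [/torsion_freeP T|[/torsion_freeP T1 /torsion_freeP T2]].
  split; apply/torsion_freeP => X Y f p sf.
    have E (h : M1 -> R) : smooth h -> torsion D1 X Y h p =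
        (c * f2 q0) ^+ 2 / k (p, q0) * torsion D1 X Y f1 p * G1 p h.
      move=> sh; have := T (hlift X) (hlift Y) _ (p, q0) (smooth_hfun sh).
      rewrite torsion_hh; last exact: smooth_hfun.
      by move=> /eqP; rewrite subr_eq0 => /eqP.
    (* For [h = f1] the relation [E] reads (1 - b1 (c f2)^2 / k) t = 0, and the
       factor is 1 / k. *)
    suff T0 : torsion D1 X Y f1 p = 0 by rewrite E// T0 mulr0 mul0r.
    have := E f1 sf1; have := lt0r_neq0 (warp_factor_gt0 (p, q0)); rewrite /k /=.
    move: (torsion _ _ _ _ _) (G1 p f1) (f2 q0) => t b r k0 tE.
    have : (1 + (c * r) ^+ 2 * b) * t = (c * r) ^+ 2 * b * t.
      by rewrite {1}tE; field.
    by rewrite mulrDl mul1r => /eqP; rewrite -subr_eq0 addrK => /eqP.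
  have := T (vlift X) (vlift Y) _ (p0, p) (smooth_vfun sf).
  by rewrite torsion_vv//; exact: smooth_vfun.
apply/torsion_freeP => X Y f z sf.
have [X1 [X2 XE]] := tangent_lift (X z); have [Y1 [Y2 YE]] := tangent_lift (Y z).
rewrite (torsion_eq D sf XE YE) torsion_lift// torsion_hh// torsion_vv//.
rewrite !T1// ?T2//; first by rewrite mulr0 mul0r subrr addr0.
  exact: smooth_slicer.
exact: smooth_slicel.
Qed.

Lemma statistical_manifold_induced :
  (statistical_manifold D1 g1 /\ statistical_manifold D2 g2) <->
  statistical_manifold D g.
Proof.
have [p0 _] := @mspace_nonempty _ _ M1; have [q0 _] := @mspace_nonempty _ _ M2.
split=> [[[T1 S1] [T2 S2]]|[/torsion_free_induced[T1 T2] S]].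
  split; first exact/torsion_free_induced.
  move=> X Y Z; apply/funext => z.
  have [X1 [X2 XE]] := tangent_lift (X z); have [Y1 [Y2 YE]] := tangent_lift (Y z).
  have [Z1 [Z2 ZE]] := tangent_lift (Z z).
  rewrite (nabla_metric_eq D g XE YE ZE) (nabla_metric_eq D g YE XE ZE).
  by rewrite !nabla_metric_lift S1 S2.
split; split => // X Y Z; apply/funext => p.
  by have := congr1 (fun h => h (p, q0)) (S (hlift X) (hlift Y) (hlift Z));
     rewrite !nabla_metric_hhh.
have := congr1 (fun h => h (p0, p)) (S (vlift X) (vlift Y) (vlift Z)).
rewrite !nabla_metric_vvv; apply: mulfI.
by rewrite expf_neq0// gt_eqF.
Qed.

End induced.

Theorem proposition7 (R : realType) (n1 n2 : nat)
    (M1 : manifold R n1) (M2 : manifold R n2)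
    (g1 : riemannian M1) (g2 : riemannian M2)
    (f1 : M1 -> R) (f2 : M2 -> R)
    (f1_smooth : smooth f1) (f2_smooth : smooth f2)
    (f1_gt0 : forall p : M1, 0 < f1 p) (f2_gt0 : forall q : M2, 0 < f2 q)
    (c : R)
    (g : riemannian (prod_manifold M1 M2))
    (gE : forall (z : prod_manifold M1 M2) (u v : tangent z),
      g z u v = warped_metric c g1 g2 f1 f2 u v)
    (G1 : vfield M1) (G2 : vfield M2)
    (G1_grad : is_gradient g1 f1 G1) (G2_grad : is_gradient g2 f2 G2)
    (D1 : connection M1) (D2 : connection M2)
    (D : connection (prod_manifold M1 M2))
    (D_induced : induced_connection c g1 g2 f1 f2 G1 G2 D1 D2 D) :
  (statistical_manifold D1 g1 /\ statistical_manifold D2 g2) <->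
  statistical_manifold D g.
Proof.
exact: (statistical_manifold_induced f1_smooth f2_smooth f1_gt0 gE G1_grad G2_grad
  D_induced).
Qed.
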